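(* Let $1<\mu<2$, $0\le\nu\le1$, $h>0$, $T>0$, $A,\Omega\in\mathbb{R}^{d\times d}$ (not assumed to commute), $f\in C([0,T],\mathbb{R}^d)$, $\varphi\in C^1([-h,0],\mathbb{R}^d)$ and $a_0,a_1\in\mathbb{R}^d$. The solution $z$ of the initial value problem $$ \begin{cases} D_{0,t}^{\mu,\nu}z(t)+Az(t)+\Omega z(t-h)=f(t), & t\in[0,T],\\ z(t)=\varphi(t), & -h\le t\le 0,\\ \left.\left(I_{0,t}^{(1-\nu)(2-\mu)}z\right)(t)\right|_{t=0}=a_0,\\ \left.\left(I_{0,t}^{(1-\nu)(2-\mu)-1}z\right)(t)\right|_{t=0}=a_1 \end{cases} $$ has the form, for $0<t\le T$, $$ z(t)=Y_{\mu,(\mu-2)(1-\nu)+1}^{h}(t)\,a_0+Y_{\mu,(\mu-2)(1-\nu)+2}^{h}(t)\,a_1-\int_{-h}^{0}Y_{\mu,\mu}^{h}(t-s-h)\,\Omega\,\varphi(s)\,ds+\int_0^tY_{\mu,\mu}^{h}(t-s)f(s)\,ds . $$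
   Context: Fractional integral: for $\gamma>0$, $I_{a,t}^{\gamma}f(t)=\frac{1}{\Gamma(\gamma)}\int_a^t(t-s)^{\gamma-1}f(s)\,ds$ (Riemann-Liouville), and $I^0_{a,t}$ is the identity. For $0\le\beta<1$, $I_{0,t}^{\beta-1}z$ denotes $\frac{d}{dt}I_{0,t}^{\beta}z$. Values at $t=0$ in the last two initial conditions are understood as limits $t\to0^+$. Hilfer derivative: for $m\in\mathbb{N}$, $m-1<\mu<m$, $0\le\nu\le1$, the Hilfer fractional derivative of order $\mu$ and type $\nu$ with lower limit $a$ is $$D_{a,t}^{\mu,\nu}f(t)=I_{a,t}^{\nu(m-\mu)}\frac{d^m}{dt^m}I_{a,t}^{(1-\nu)(m-\mu)}f(t);$$ here $m=2$, $a=0$. Delayed Mittag-Leffler type matrix function: let $I$ and $\Theta$ be the identity and zero $d\times d$ matrices and define matrices $Q_{k,m}$ ($k,m=0,1,2,\dots$) by $Q_{k,0}=A^k$ (so $Q_{0,0}=I$), $Q_{0,m}=\Theta$ for $m\ge1$, and $$Q_{k,m}=\sum_{j=m}^{k}A^{k-j}\,\Omega\, Q_{j-1,m-1}\quad (k,m\ge1),$$ an empty sum being $\Theta$; equivalently $Q_{k+1,m}=AQ_{k,m}+\Omega Q_{k,m-1}$ with $Q_{k,-1}=\Theta$. For $\gamma>0$, $$Y_{\mu,\gamma}^{h}(t)=Y_{\mu,\gamma}^{h}(A,\Omega;t)=\sum_{m=0}^{\infty}\sum_{k=0}^{\infty}(-1)^kQ_{k,m}\frac{(t-mh)_+^{k\mu+\gamma-1}}{\Gamma(k\mu+\gamma)}\in\mathbb{R}^{d\times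 d},\qquad (t)_+=\max\{0,t\},$$ where terms with $k<m$ (for which $Q_{k,m}=\Theta$) are zero. The same formula is used for negative arguments of $Y_{\mu,\mu}^h$, where it gives $\Theta$. *)

(* Defs.v *)
From HB Require Import structures.
From mathcomp Require Import all_boot all_order all_algebra.
From mathcomp Require Import all_classical all_reals all_analysis.
Import Order.TTheory GRing.Theory Num.Theory.
Import numFieldNormedType.Exports.

Set Implicit Arguments.
Unset Strict Implicit.
Unset Printing Implicit Defensive.

Local Open Scope classical_set_scope.
Local Open Scope ring_scope.

Section VectorValued.
Context {R : realType} {d : nat}.
Implicit Types (D : set R) (f : R -> 'cV[R]_d).

(* Lebesgue integral and integrability, componentwise. *)
Definition vintegral D f : 'cV[R]_d :=
  \col_i \int[lebesgue_measure]_(s in D) f s i ord0.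

Definition vintegrable D f : Prop :=
  forall i, lebesgue_measure.-integrable D (EFin \o (fun s => f s i ord0)).

(* C^1 on the closed interval [a, b]: the derivative at an endpoint is the
   one-sided one, and no value of f outside [a, b] matters. *)
Definition C1_segment (a b : R) f : Prop :=
  exists2 df : R -> 'cV[R]_d,
    {within `[a, b], continuous df} &
    forall t, t \in `[a, b] ->
      (s - t)^-1 *: (f s - f t) @[s --> within `[a, b] t^'] --> df t.

(* Absolute continuity on [a, b]; the [x i, y i] are finitely many pairwise
   non-overlapping (possibly degenerate) subintervals. *)
Definition abs_continuous (a b : R) f : Prop :=
  forall e : R, 0 < e -> exists2 delta : R, 0 < delta &
    forall (n : nat) (x y : 'I_n -> R),
      (forall i, [/\ a <= x i, x i <= y i & y i <= b]) ->
      (forall i j, i != j -> y i <= x j \/ y j <= x i) ->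
      \sum_i (y i - x i) < delta ->
      \sum_i `|f (y i) - f (x i)| < e.

End VectorValued.

Definition Gamma {R : realType} (x : R) : R :=
  \int[lebesgue_measure]_(t in `]0, +oo[) (t `^ (x - 1) * expR (- t)).

Section FractionalCalculus.
Context {R : realType} {d : nat}.
Implicit Types (a gamma mu nu t : R) (f : R -> 'cV[R]_d).

(* I_{a,t}^gamma f, for gamma >= 0. *)
Definition frac_int a gamma f t : 'cV[R]_d :=
  if gamma == 0 then f t
  else (Gamma gamma)^-1 *:
       vintegral `[a, t] (fun s => (t - s) `^ (gamma - 1) *: f s).

(* I_{a,t}^{beta - 1} f, for 0 <= beta < 1. *)
Definition frac_int_pred a beta f : R -> 'cV[R]_d := derive1 (frac_int a beta f).

(* D_{a,t}^{mu,nu} f, for m - 1 < mu < m. *)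
Definition hilfer (m : nat) a mu nu f : R -> 'cV[R]_d :=
  frac_int a (nu * (m%:R - mu))
    (derive1n m (frac_int a ((1 - nu) * (m%:R - mu)) f)).

(* The functions whose Hilfer derivative of order mu in ]1, 2[ makes sense on
   ]0, T[: z is continuous on ]0, T] and integrable near 0 (it may blow up at
   0+, and z 0 is unrelated to z on ]0, T]); g = I^{(1-nu)(2-mu)} z is C^1 with
   g' locally absolutely continuous, so that g'' exists almost everywhere, and
   g'' is integrable, so that I^{nu(2-mu)} g'' exists almost everywhere.  The
   values of z outside ]0, T] are not constrained. *)
Definition hilfer_regular mu nu (T : R) (z : R -> 'cV[R]_d) : Prop :=
  let g := frac_int 0 ((1 - nu) * (2 - mu)) z in
  [/\ {within `]0, T], continuous z},
      vintegrable `]0, T] z,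
      forall t, t \in `]0, T[ -> derivable g t 1,
      forall b c, 0 < b -> b <= c -> c < T -> abs_continuous b c (derive1 g) &
      vintegrable `]0, T[ (derive1n 2 g)].

End FractionalCalculus.

Section DelayedMittagLeffler.
Context {R : realType} {d : nat}.
Implicit Types (A Omega : 'M[R]_d).

(* Q_{k,m}.  For k = 0 and m >= 1 the sum is empty, which gives Q_{0,m} = 0. *)
Fixpoint Qmx A Omega (k m : nat) {struct m} : 'M[R]_d :=
  if m is m'.+1 then
    \sum_(m <= j < k.+1) A ^+ (k - j) *m Omega *m Qmx A Omega j.-1 m'
  else A ^+ k.

(* Y_{mu,gamma}^h(A, Omega; t), as an iterated sum: over k inside, m outside. *)
Definition delayed_ML (h mu gamma : R) A Omega (t : R) : 'M[R]_d :=
  limn (series (fun m : nat => limn (series (fun k : nat =>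
    ((-1) ^+ k * (Num.max 0 (t - m%:R * h) `^ (k%:R * mu + gamma - 1)
                  / Gamma (k%:R * mu + gamma))) *: Qmx A Omega k m)))).

End DelayedMittagLeffler.

(* Main.v *)
Require Import Defs.
From HB Require Import structures.
From mathcomp Require Import all_boot all_order all_algebra.
From mathcomp Require Import all_classical all_reals all_analysis.
From mathcomp Require Import measurable_realfun.
From mathcomp Require Import ring lra.
Import Order.TTheory GRing.Theory Num.Theory.
Import numFieldNormedType.Exports.
Set Implicit Arguments.
Unset Strict Implicit.
Unset Printing Implicit Defensive.
Local Open Scope classical_set_scope.
Local Open Scope ring_scope.

(** The fractional equation is turned into a Volterra integral equation, and that
    equation is solved by iteration, which produces the delayed Mittag-Leffler
    series term by term.

    Let [I^a] be the fractional integral of order [a] from 0, that is the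
    convolution with the kernel [k_a t = t ^ (a - 1) / Gamma a] on [t > 0]
    ([rl_kernel]).  Fubini and the Beta integral give [k_a * k_b = k_(a + b)]
    ([rl_kernel_conv]), hence the semigroup law [I^a (I^b u) = I^(a + b) u]
    ([conv_semigroup]).

    Put [beta = (1 - nu) (2 - mu)], [alpha = nu (2 - mu)] and [g = I^beta z].  The
    derivative of [g] is absolutely continuous, so it is the integral of its
    almost everywhere derivative [g''] ([AC_FTC]: Jordan decomposition,
    Radon-Nikodym for Lebesgue-Stieltjes measures, Lebesgue differentiation), and
    the initial conditions give [g = a0 + a1 t + I^2 g''] ([taylor2]).  The
    equation reads [I^alpha g'' = F] with [F = f - A z - Omega z (. - h)].  Since
    [2 - alpha = mu + beta], applying [I^(2 - alpha)] gives
    [I^beta z = a0 + a1 t + I^(mu + beta) F].  Applying [I^(1 - beta)] and then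
    differentiating once yields ([volterra_of_hilfer])
    [z = a0 k_(1 - beta) + a1 k_(2 - beta) + I^mu F].

    The history [phi] enters [F] only through [Omega phi (s - h)] for [0 < s <= h],
    so it is moved to the source term; [z] is then extended by 0 to the left of 0.
    Substituting the equation into itself [n] times ([neumann]) gives a sum over
    all words of length [k < n] in the letters [A] and [Omega], the latter
    accompanied by a delay [h].  The sum of the words of length [k] with [j]
    letters [Omega] is [Q_(k, j)], and its coefficient is
    [(-1) ^ k k_(k mu + gamma) (t - j h)]: the series of the statement.  The
    remainder tends to 0 because Gamma outgrows every geometric progression
    ([Gamma_growth], [ker_geometric]), whereas the norm of [Q_(k, j)] grows at
    most geometrically ([Qmx_norm]).  The same bound lets dominated convergence
    exchange the series with the convolution against the source
    ([conv_ML_cvg], [representation]).  Translating by [h] the part of the source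
    that comes from [phi] gives the integral over [[-h, 0]] ([source_formula]). *)

(** * Absolute continuity and total variation *)

Section AbsolutelyContinuous.
Context {R : realType}.
Notation mu := (@lebesgue_measure R).
Notation TV := total_variation.
Implicit Types (F P : R -> R) (L : seq (R * R)).

Definition nonoverlap (p q : R * R) : bool := (p.2 <= q.1) || (q.2 <= p.1).
Definition intervals L : bool :=
  all (fun p => p.1 <= p.2) L && pairwise nonoverlap L.
Definition total_length L : R := \sum_(p <- L) (p.2 - p.1).
Definition oscillation F L : R := \sum_(p <- L) `|F p.2 - F p.1|.
(** Finite families are lists, so that a member can be refined in place, and the
    bound on the oscillation is not strict, so that it passes to suprema. *)
Definition AC F := forall e, 0 < e -> exists2 delta, 0 < delta &
  forall L, intervals L -> total_length L < delta -> oscillation F L <= e.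

Lemma nonoverlap_sym : symmetric nonoverlap.
Proof. by move=> p q; rewrite /nonoverlap orbC. Qed.

Lemma total_length_cat L1 L2 :
  total_length (L1 ++ L2) = total_length L1 + total_length L2.
Proof. exact: big_cat. Qed.

Lemma oscillation_cat F L1 L2 :
  oscillation F (L1 ++ L2) = oscillation F L1 + oscillation F L2.
Proof. exact: big_cat. Qed.

Lemma intervals_cat L1 L2 : intervals (L1 ++ L2) =
  [&& intervals L1, intervals L2 & allrel nonoverlap L1 L2].
Proof.
rewrite /intervals all_cat pairwise_cat.
by case: all; case: all; case: pairwise; case: pairwise; rewrite //= ?andbT ?andbF.
Qed.

Fixpoint steps (x : R) (s : seq R) : seq (R * R) :=
  if s is y :: s' then (x, y) :: steps y s' else [::].

Lemma steps_in x s : path <%R x s ->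
  forall p, p \in steps x s -> [/\ x <= p.1, p.1 <= p.2 & p.2 <= last x s].
Proof.
elim: s x => [//|y s IH] x /= /andP[xy ys] p; rewrite inE => /predU1P[->/=|ps].
  split => //; first exact: ltW.
  have := IH _ ys; case: (s) ys => [//|y' s'] /= /andP[yy' ys'] /(_ (y, y')).
  by rewrite inE eqxx => /(_ isT)[_ _]; apply: le_trans; apply: ltW.
have [h1 h2 h3] := IH _ ys _ ps; split => //.
exact: le_trans (ltW xy) h1.
Qed.

Lemma steps_intervals x s : path <%R x s -> intervals (steps x s).
Proof.
elim: s x => [//|y s IH] x /= /andP[xy ys].
have /andP[a1 a2] := IH _ ys.
rewrite /intervals /= ltW//= a1 a2 /= andbT.
apply/allP => p /(steps_in ys)[h1 h2 h3].
by rewrite /nonoverlap /= h1.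
Qed.

Lemma steps_length x s : total_length (steps x s) = last x s - x.
Proof.
elim: s x => [|y s IH] x /=; first by rewrite /total_length big_nil subrr.
by rewrite /total_length big_cons -/(total_length _) IH /=; lra.
Qed.

Lemma steps_oscillation F x y s : itv_partition x y s ->
  oscillation F (steps x s) = variation x y F s.
Proof.
move=> h; rewrite variation_zip//; case: h => _ _.
elim: s x => [|z s IH] x /=; rewrite /oscillation ?big_nil//.
by rewrite !big_cons /= -/(oscillation _ _) IH.
Qed.

Lemma oscillation_ge0 F L : 0 <= oscillation F L.
Proof. exact: sumr_ge0. Qed.

(** Refining a member into the steps of a partition leaves the total length
    unchanged, so the intervals may be refined, and the supremum over the
    refinements taken, one at a time: [L1] holds the intervals that are to be
    replaced by their total variation, [L2] those that are kept. *)
Lemma TV_family F (e delta : R) :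
  (forall L, intervals L -> total_length L < delta -> oscillation F L <= e) ->
  forall L1 L2, intervals (L1 ++ L2) -> total_length (L1 ++ L2) < delta ->
  (\sum_(p <- L1) TV p.1 p.2 F + (oscillation F L2)%:E <= e%:E)%E.
Proof.
move=> He; elim=> [|[x y] L1 IH] L2 hi hl.
  by rewrite big_nil add0e lee_fin; exact: He.
have /and3P[xy oL iL] : [&& x <= y, all (nonoverlap (x, y)) (L1 ++ L2) &
    intervals (L1 ++ L2)].
  move: hi; rewrite /intervals /=.
  by case: (x <= y) => //=; case: all => //=; case: (all _ _) => //=.
have rest0 : (0 <= \sum_(p <- L1) TV p.1 p.2 F)%E.
  rewrite big_seq; apply: sume_ge0 => p pL1.
  apply: total_variation_ge0.
  by move: iL => /andP[/allP + _]; apply; rewrite mem_cat pL1.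
(* the induction hypothesis, for the steps of the partition [s] of the first interval *)
have ref s : itv_partition x y s ->
  (\sum_(p <- L1) TV p.1 p.2 F + (variation x y F s + oscillation F L2)%:E
    <= e%:E)%E.
  move=> hs; have [ps /eqP lst] := hs.
  have := IH (steps x s ++ L2).
  rewrite oscillation_cat (steps_oscillation _ hs).
  apply.
    move: iL oL; rewrite !intervals_cat => /and3P[-> -> ac].
    rewrite all_cat => /andP[/allP o1 /allP o2].
    rewrite (steps_intervals ps) /= allrel_catr ac andbT; apply/andP; split.
      apply/allrelP => q p qs pL2; have [] := steps_in ps qs; rewrite lst => q1 q2 q3.
      rewrite nonoverlap_sym.
      have := o2 _ pL2; rewrite /nonoverlap /= => /orP[?|?]; apply/orP.
        by right; apply: le_trans q3 _.
      by left; exact: le_trans q1.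
    apply/allrelP => p q pL1 qs; have [] := steps_in ps qs; rewrite lst => q1 q2 q3.
    rewrite nonoverlap_sym.
    have := o1 _ pL1; rewrite /nonoverlap /= => /orP[?|?]; apply/orP.
      by left; apply: le_trans q3 _.
    by right; exact: le_trans q1.
  move: hl; rewrite -cat1s !total_length_cat steps_length lst.
  by rewrite {1}/total_length big_seq1 /=; lra.
have fin : (\sum_(p <- L1) TV p.1 p.2 F)%E \is a fin_num.
  rewrite ge0_fin_numE//.
  have [s hs] : exists s, itv_partition x y s.
    move: xy; rewrite le_eqVlt => /predU1P[->|xy]; first by exists [::].
    by exists [:: y]; exact: itv_partition1.
  have := ref s hs => /le_lt_trans -/(_ +oo%E) /(_ (ltry _)).
  apply: le_lt_trans; rewrite leeDl// lee_fin addr_ge0 ?variation_ge0//.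
  exact: oscillation_ge0.
rewrite big_cons /= -addeA addeC.
rewrite -leeBrDl; last first.
  by rewrite fin_numD fin.
apply: ge_ereal_sup => _ [_ [s hs <-] <-].
rewrite leeBrDl ?fin_numD ?fin//.
have := ref s hs; rewrite EFinD => h.
by rewrite -addeA [X in (_ + X)%E]addeC.
Qed.

Lemma intervals_map (g : R -> R) L : {homo g : x y / x <= y} ->
  intervals L -> intervals [seq (g p.1, g p.2) | p <- L].
Proof.
move=> gle /andP[/allP h1 h2]; apply/andP; split.
  by rewrite all_map; apply/allP => p pL /=; apply/gle/h1.
rewrite pairwise_map; apply: sub_pairwise h2 => p q.
by rewrite /nonoverlap /= => /orP[/gle ->|/gle ->]; rewrite ?orbT.
Qed.

Lemma total_length_map (g : R -> R) L :
  (forall x y, x <= y -> g y - g x <= y - x) -> intervals L ->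
  total_length [seq (g p.1, g p.2) | p <- L] <= total_length L.
Proof.
move=> glip /andP[/allP h1 _]; rewrite /total_length big_map /=.
by rewrite !big_seq; apply: ler_sum => p pL; apply/glip/h1.
Qed.

Lemma AC_sub F G : AC F -> AC G -> AC (F \- G).
Proof.
move=> acF acG e e0; have e20 : 0 < e / 2 by lra.
have [d1 d10 H1] := acF _ e20; have [d2 d20 H2] := acG _ e20.
exists (Num.min d1 d2); first by rewrite lt_min d10.
move=> L hL; rewrite lt_min => /andP[l1 l2].
rewrite [e]splitr; apply: le_trans (lerD (H1 _ hL l1) (H2 _ hL l2)).
rewrite /oscillation -big_split /=; apply: ler_sum => p _.
apply: le_trans (ler_normB _ _); rewrite le_eqVlt; apply/orP; left.
by apply/eqP; congr (`|_|); lra.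
Qed.

Lemma AC_continuous F : AC F -> continuous F.
Proof.
move=> acF x; apply/cvgrPdist_le => e e0; have [d d0 H] := acF e e0.
near=> y.
have yx : `|x - y| < d by near: y; exact: cvgr_dist_lt.
have [xy|yx'] := leP x y.
  have := H [:: (x, y)]; rewrite /intervals /total_length /oscillation !big_seq1 /=.
  by rewrite xy distrC; apply => //; rewrite -(ger0_norm (x := y - x)) ?subr_ge0 1?distrC.
have := H [:: (y, x)]; rewrite /intervals /total_length /oscillation !big_seq1 /=.
by rewrite ltW//; apply => //; rewrite -(gtr0_norm (x := x - y)) ?subr_gt0.
Unshelve. all: by end_near. Qed.

(** An interval shorter than the [delta] of [e = 1] has total variation at most 1,
    and finitely many of them cover [[x, y]]. *)
Lemma AC_TV_fin F x y : AC F -> x <= y -> TV x y F \is a fin_num.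
Proof.
move=> /(_ 1 ltr01)[d d0 H] xy.
have small u v : u <= v -> v - u < d -> TV u v F \is a fin_num.
  move=> uv vu; have := @TV_family F 1 d H [:: (u, v)] [::].
  rewrite /intervals /total_length /oscillation cats0 !big_seq1 /= uv !big_nil.
  move=> /(_ isT vu); rewrite adde0 => h.
  rewrite ge0_fin_numE ?total_variation_ge0//.
  by apply: le_lt_trans h _; exact: ltry.
have [n hn] : exists n : nat, y - x <= n%:R * (d / 2).
  exists (Num.truncn ((y - x) / (d / 2))).+1; rewrite -ler_pdivrMr ?divr_gt0//.
  by apply/ltW/truncnS_gt.
elim: n x xy hn => [|n IH] x xy hn.
  by apply: small => //; rewrite mul0r in hn; lra.
have [h|h] := leP y (x + d / 2); first by apply: small => //; lra.
rewrite (@total_variationD _ _ _ (x + d / 2)) ?fin_numD; [|lra|lra].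
rewrite small; [|lra|lra]; rewrite IH//; first lra.
by move: hn; rewrite -natr1; lra.
Qed.

Definition variation_from (b : R) F (x : R) : R := fine (TV b (Num.max b x) F).

Lemma variation_fromB b F x y : AC F -> x <= y ->
  variation_from b F y - variation_from b F x =
  fine (TV (Num.max b x) (Num.max b y) F).
Proof.
move=> acF xy; rewrite /variation_from.
have bx : b <= Num.max b x by rewrite le_max lexx.
have mxy : Num.max b x <= Num.max b y.
  by rewrite ge_max !le_max lexx xy orbT.
rewrite (total_variationD _ bx mxy) fineD ?AC_TV_fin//; lra.
Qed.

Lemma max_homo (b : R) : {homo Num.max b : x y / x <= y}.
Proof. by move=> x y xy; rewrite ge_max !le_max lexx xy orbT. Qed.

Lemma max_lip (b x y : R) : x <= y -> Num.max b y - Num.max b x <= y - x.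
Proof. by move=> xy; case: (leP b x) => ?; case: (leP b y) => ?; lra. Qed.

Lemma AC_variation_from b F : AC F -> AC (variation_from b F).
Proof.
move=> acF e e0; have [d d0 H] := acF e e0; exists d => // L hL hl.
have := @TV_family F e d H [seq (Num.max b p.1, Num.max b p.2) | p <- L] [::].
rewrite cats0 => /(_ (intervals_map (@max_homo b) hL)
  (le_lt_trans (total_length_map (@max_lip b) hL) hl)).
rewrite {1}/oscillation big_nil adde0 big_map /= -lee_fin; apply: le_trans.
rewrite /oscillation -sumEFin !big_seq; apply: lee_sum => p pL.
have p12 : p.1 <= p.2 by move: hL => /andP[/allP + _]; apply.
have mp := @max_homo b _ _ p12.
rewrite variation_fromB// ger0_norm ?fine_ge0 ?total_variation_ge0//.
by rewrite fineK// AC_TV_fin.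
Qed.

Lemma variation_from_nd b F : AC F -> {homo variation_from b F : x y / x <= y}.
Proof.
move=> acF x y xy; rewrite -subr_ge0 variation_fromB//.
by rewrite fine_ge0// total_variation_ge0//; exact: max_homo.
Qed.

(** Jordan decomposition: an increment of [F] is at most its total variation.  The
    hypothesis makes [F] constant to the left of [b], as [variation_from b F] is. *)
Lemma variation_fromB_nd b F : AC F -> (forall x, F (Num.max b x) = F x) ->
  {homo (variation_from b F \- F) : x y / x <= y}.
Proof.
move=> acF Fb x y xy; rewrite /= -subr_ge0.
have -> : variation_from b F y - F y - (variation_from b F x - F x) =
  (variation_from b F y - variation_from b F x) - (F y - F x) by lra.
rewrite variation_fromB// subr_ge0 (le_trans (ler_norm _))//.
rewrite -lee_fin fineK ?AC_TV_fin ?max_homo//.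
by rewrite -{1}(Fb y) -{1}(Fb x); apply: total_variation_ge; exact: max_homo.
Qed.

End AbsolutelyContinuous.

(** * Densities of absolutely continuous functions *)

Section LebesgueStieltjes.
Context {R : realType}.
Notation mu := (@lebesgue_measure R).
Implicit Types (F : cumulative R R).

Lemma lebesgue_stieltjes_itv_oc F (a b : R) : a <= b ->
  lebesgue_stieltjes_measure F `]a, b]%classic = (F b - F a)%:E.
Proof.
move=> ab; rewrite /lebesgue_stieltjes_measure/= /measure_extension/=.
by rewrite measurable_mu_extE//= ?wlength_itv_bnd//; exact: is_ocitv.
Qed.

(** An unbounded interval contains a half-line. *)
Lemma finite_itv_bounded (i : interval R) : [set` i] !=set0 ->
  (mu [set` i] < +oo)%E -> has_lbound [set` i] /\ has_ubound [set` i].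
Proof.
case: i => [[xa a|[|]] [xb b|[|]]] [x /= xi]; rewrite ?set_itvE//;
  rewrite ?lebesgue_measure_itv //= ?ltry ?ltNyr //=;
  try by move: xi; rewrite in_itv /= ?andbF.
by rewrite -set_itvNyy lebesgue_measure_itv.
Qed.

Lemma open_itv_bounded (X : set R) : open X -> is_interval X -> X !=set0 ->
  (mu X < +oo)%E -> X = `]inf X, sup X[%classic.
Proof.
move=> oX iX X0 muX.
have XE := (is_intervalP X).1 iX.
have bnd : has_lbound X /\ has_ubound X.
  by rewrite XE; apply: finite_itv_bounded; rewrite -XE.
rewrite -{1}((interior_id X).1 oX) (interval_bounded_interior iX bnd.1 bnd.2).
by apply/seteqP; split => x /=; rewrite in_itv.
Qed.

Lemma disjoint_oo_nonoverlap (p q : R * R) : p.1 < p.2 -> q.1 < q.2 ->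
  `]p.1, p.2[%classic `&` `]q.1, q.2[%classic = set0 -> nonoverlap p q.
Proof.
move=> p12 q12 pq0; rewrite /nonoverlap; apply: contraPT pq0.
rewrite negb_or -!ltNge => /andP[h1 h2]; apply/eqP/set0P.
exists ((Num.max p.1 q.1 + Num.min p.2 q.2) / 2).
have : Num.max p.1 q.1 < Num.min p.2 q.2.
  by rewrite lt_min !gt_max p12 q12 h1 h2.
move=> h; have h' := midf_lt h.
split; rewrite /= in_itv /=; apply/andP; split.
- by apply: le_lt_trans h'.1; rewrite le_max lexx.
- by apply: lt_le_trans h'.2 _; rewrite ge_min lexx.
- by apply: le_lt_trans h'.1; rewrite le_max lexx orbT.
- by apply: lt_le_trans h'.2 _; rewrite ge_min lexx orbT.
Qed.

(** An open set is a countable disjoint union of open intervals, and finitely many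
    of them form a family to which absolute continuity applies. *)
Lemma AC_lebesgue_stieltjes_open F (e delta : R) (U : set R) :
  (forall L, intervals L -> total_length L < delta -> oscillation F L <= e) ->
  open U -> (mu U < delta%:E)%E -> (lebesgue_stieltjes_measure F U <= e%:E)%E.
Proof.
move=> He oU muU; pose I := open_disjoint_itv oU.
have oI n : open (I n) := @open_disjoint_itv_open _ _ oU n.
have iI n : is_interval (I n) := @open_disjoint_itv_is_interval _ _ oU n.
have tI : trivIset setT I := @open_disjoint_itv_trivIset _ _ oU.
have UE : U = \bigcup_n I n := @open_disjoint_itv_bigcup _ _ oU.
clearbody I; have mI n : measurable (I n) by exact: open_measurable.
have muI n : (mu (I n) < +oo)%E.
  apply: le_lt_trans (lt_trans muU (ltry _)); apply: le_measure; rewrite ?inE;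
    [exact: mI|exact: open_measurable|].
  by rewrite UE; exact: bigcup_sup.
have [p hp] : {p : nat -> R * R &
    forall n, I n = `](p n).1, (p n).2[%classic /\ (p n).1 <= (p n).2}.
  apply: (@choice _ _ (fun n p => I n = `]p.1, p.2[%classic /\ p.1 <= p.2)) => n.
  have [I0|I0] := eqVneq (I n) set0; first by exists (0, 0); rewrite /= set_itvoo0.
  have I0' : I n !=set0 by exact/set0P.
  exists (inf (I n), sup (I n)); split; first exact: open_itv_bounded.
  have [x] := I0'; rewrite [X in X x -> _]open_itv_bounded//= in_itv /=.
  by move=> /andP[h1 h2]; apply: ltW (lt_trans h1 h2).
(* degenerate intervals are left out: a point inside another interval overlaps it *)
have LS n : (lebesgue_stieltjes_measure F (I n) <=
    (if (p n).1 < (p n).2 then `|F (p n).2 - F (p n).1| else 0)%:E)%E.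
  have [-> p12] := hp n; case: ifPn => [lt12|]; last first.
    by rewrite -leNgt => le21; rewrite set_itv_ge ?measure0// bnd_simp -leNgt.
  apply: le_trans (_ : (lebesgue_stieltjes_measure F `](p n).1, (p n).2]%classic
     <= _)%E).
    apply: le_measure; rewrite ?inE; [exact: measurable_itv|exact: measurable_itv|].
    by apply: subset_itvl; rewrite bnd_simp.
  by rewrite lebesgue_stieltjes_itv_oc// lee_fin ler_norm.
rewrite UE measure_semi_bigcup//; last by rewrite -UE; exact: open_measurable.
apply: lime_le; first exact: is_cvg_nneseries.
near=> N; rewrite big_mkord.
apply: le_trans; first by apply: lee_sum => i _; exact: LS.
rewrite sumEFin lee_fin -big_mkcond /=.
pose L := [seq p n | n <- index_iota 0 N & (p n).1 < (p n).2].
have -> : \sum_(i < N | (p i).1 < (p i).2) `|F (p i).2 - F (p i).1| =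
    oscillation F L.
  by rewrite /oscillation big_map big_filter big_mkord.
apply: He.
  apply/andP; split.
    apply/allP => q /mapP[n]; rewrite mem_filter => /andP[_ _] ->.
    exact: (hp n).2.
  rewrite pairwise_map.
  have : pairwise (fun m n => m != n) [seq n <- index_iota 0 N | (p n).1 < (p n).2].
    by rewrite -uniq_pairwise filter_uniq// iota_uniq.
  have : all (fun n => (p n).1 < (p n).2)
      [seq n <- index_iota 0 N | (p n).1 < (p n).2] by exact: filter_all.
  elim: [seq n <- _ | _] => //= n s IH /andP[pn ps] /andP[ns us].
  rewrite IH// andbT; apply/allP => m ms /=.
  apply: disjoint_oo_nonoverlap => //; first exact: (allP ps).
  rewrite -(hp n).1 -(hp m).1.
  by move/trivIsetP : tI; apply=> //; exact: (allP ns).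
rewrite -lte_fin; apply: le_lt_trans muU.
rewrite UE measure_semi_bigcup//; last by rewrite -UE; exact: open_measurable.
apply: le_trans (nneseries_lim_ge N _); last by [].
rewrite /total_length big_map big_filter big_mkord -sumEFin big_mkcond big_mkord.
apply: lee_sum => i _; have := lebesgue_measure_itv `](p i).1, (p i).2[.
by rewrite -(hp i).1 /= lte_fin => ->; case: ifP.
Unshelve. all: by end_near. Qed.

(** By outer regularity a null set lies in open sets of arbitrarily small Lebesgue
    measure. *)
Lemma AC_lebesgue_stieltjes_dominates F : AC F ->
  lebesgue_stieltjes_measure F `<< mu.
Proof.
move=> acF; apply/null_content_dominatesP => N mN N0.
apply/eqP; rewrite eq_le measure_ge0 andbT.
apply/lee_addgt0Pr => e e0; rewrite add0e.
have [delta d0 He] := acF e e0.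
have N0' : mu N = 0%E by exact: N0.
have Nfin : (mu N < +oo)%E by rewrite N0' ltry.
have [U [oU NU muU]] := @lebesgue_regularity_outer _ N delta mN Nfin d0.
have mU : measurable U by exact: open_measurable.
have mUN : measurable (U `\` N) by exact: measurableD.
have muU' : (mu U < delta%:E)%E.
  apply: le_lt_trans muU.
  have : (mu U <= mu (U `\` N) + mu N)%E.
    apply: le_trans (measureU2 _ _ _) => //.
    apply: le_measure; rewrite ?inE//; first exact: measurableU.
    by move=> x Ux /=; have [|] := pselect (N x); [right|left].
  by rewrite N0' adde0.
apply: le_trans (AC_lebesgue_stieltjes_open He oU muU').
by apply: le_measure; rewrite ?inE.
Qed.

(** The density is a Radon-Nikodym derivative of the Lebesgue-Stieltjes measure of
    [G], restricted to [ ]b, c] ] to make it finite. *)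
Lemma AC_nondecreasing_density (G : R -> R) (b c : R) : AC G ->
  {homo G : x y / x <= y} -> b <= c ->
  exists2 rho : R -> R, mu.-integrable setT (EFin \o rho) &
    forall x, b <= x <= c -> G x - G b = \int[mu]_(t in `]b, x]) rho t.
Proof.
move=> acG ndG bc.
pose F : cumulative R R := HB.pack G (isCumulative.Build R _ R G ndG
  (right_continuousW (AC_continuous acG))).
have acF : AC F by [].
pose nu := lebesgue_stieltjes_measure F.
have mD : measurable (`]b, c]%classic : set (measurableTypeR R)).
  exact: measurable_itv.
have nuD : (nu `]b, c]%classic < +oo)%E.
  by rewrite /nu lebesgue_stieltjes_itv_oc// ltry.
have dom : mfrestr mD nuD `<< mu.
  apply/null_content_dominatesP => N mN N0; rewrite /mfrestr /mrestr.
  have /null_content_dominatesP := AC_lebesgue_stieltjes_dominates acF.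
  apply; first exact: measurableI.
  apply/eqP; rewrite eq_le measure_ge0 andbT -N0.
  by apply: le_measure; rewrite ?inE//; exact: measurableI.
pose rho := Radon_Nikodym_SigmaFinite.f (mfrestr mD nuD) mu.
have rho_fin x : rho x \is a fin_num by exact: Radon_Nikodym_SigmaFinite.f_fin_num.
have rho_int : mu.-integrable setT rho.
  exact: Radon_Nikodym_SigmaFinite.f_integrable.
have rhoK : EFin \o (fine \o rho) = rho.
  by apply/funext => x /=; rewrite fineK.
exists (fine \o rho); first by rewrite rhoK.
move=> x /andP[bx xc]; rewrite /Rintegral.
have -> : (\int[mu]_(t in `]b, x]) ((fine \o rho) t)%:E =
    \int[mu]_(t in `]b, x]) rho t)%E.
  by apply: eq_integral => t _ /=; rewrite fineK.
rewrite -Radon_Nikodym_SigmaFinite.f_integral//.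
rewrite /= /mfrestr /mrestr setIidl; last by apply: subset_itvl; rewrite bnd_simp.
by rewrite /nu lebesgue_stieltjes_itv_oc.
Qed.

End LebesgueStieltjes.

(** * Lebesgue's fundamental theorem of calculus *)

Section AbsolutelyContinuousFTC.
Context {R : realType}.
Notation mu := (@lebesgue_measure R).

(** Both terms of the Jordan decomposition are nondecreasing and absolutely
    continuous, so each of them has a density. *)
Lemma AC_density (P : R -> R) (b c : R) : AC P -> b <= c ->
  (forall x, P (Num.max b x) = P x) ->
  exists2 rho : R -> R, mu.-integrable setT (EFin \o rho) &
    forall x, b <= x <= c -> P x - P b = \int[mu]_(t in `]b, x]) rho t.
Proof.
move=> acP bc Pb.
have acV := AC_variation_from b acP.
have [r1 i1 E1] := AC_nondecreasing_density acV (variation_from_nd b acP) bc.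
have [r2 i2 E2] := AC_nondecreasing_density (AC_sub acV acP)
  (variation_fromB_nd acP Pb) bc.
exists (r1 \- r2).
  rewrite (_ : EFin \o _ = (EFin \o r1) \- (EFin \o r2))%E; last by apply/funext.
  exact: integrableB.
move=> x bxc; rewrite RintegralB//; first last.
- by apply: (integrableS measurableT).
- by apply: (integrableS measurableT).
- by rewrite -E1// -E2//=; lra.
Qed.

Definition clamp (b c x : R) := Num.min c (Num.max b x).

Lemma clamp_homo b c : {homo clamp b c : x y / x <= y}.
Proof.
by move=> x y xy; rewrite /clamp le_min !ge_min lexx max_homo// orbT.
Qed.

Lemma clamp_lip b c x y : x <= y -> clamp b c y - clamp b c x <= y - x.
Proof.
move=> xy; apply: le_trans (max_lip b xy); rewrite /clamp.
have := max_homo b xy; move: (Num.max b x) (Num.max b y) => u v uv.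
by case: (leP c u) => ?; case: (leP c v) => ?; lra.
Qed.

Lemma clamp_itv b c x : b <= c -> b <= clamp b c x <= c.
Proof. by move=> bc; rewrite /clamp le_min bc le_max lexx/= ge_min lexx. Qed.

Lemma clamp_id b c x : b <= x <= c -> clamp b c x = x.
Proof. by rewrite /clamp => /andP[bx xc]; rewrite (max_r bx) min_r. Qed.

Lemma clamp_max b c x : clamp b c (Num.max b x) = clamp b c x.
Proof. by rewrite /clamp maxA maxxx. Qed.

Lemma normr_coord (m n : nat) (M : 'M[R]_(m, n)) i j : `|M i j| <= `|M|.
Proof.
rewrite [leRHS]mx_normrE; apply: le_trans (le_bigmax _ _ (i, j)) => //.
Qed.

(** [clamp b c] extends [f] from [[b, c]] to the line by constants.  It is
    nondecreasing and 1-Lipschitz, so it maps families of intervals of the line to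
    families of intervals of [[b, c]] that are not longer. *)
Lemma abs_continuous_AC (d : nat) (b c : R) (f : R -> 'cV[R]_d) i : b <= c ->
  abs_continuous b c f -> AC (fun x => f (clamp b c x) i ord0).
Proof.
move=> bc acf.
move=> e e0; have [delta d0 H] := acf e e0; exists delta => // L0 hL0 hl0.
pose L := [seq (clamp b c p.1, clamp b c p.2) | p <- L0].
have /andP[/allP L1 L2] : intervals L by apply: intervals_map hL0; exact: clamp_homo.
have hl : total_length L < delta.
  by apply: le_lt_trans hl0; apply: total_length_map => //; exact: clamp_lip.
have Lbc p : p \in L -> (b <= p.1 <= c) /\ (b <= p.2 <= c).
  by move=> /mapP[q _ ->] /=; rewrite !clamp_itv.
have /= := H (size L) (fun k => (nth (0, 0) L k).1) (fun k => (nth (0, 0) L k).2).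
move=> /(_ _ _ _)/ltW; rewrite /oscillation => h.
apply: (@le_trans _ _ (\sum_(p <- L) `|f p.2 - f p.1|)).
  rewrite big_map; apply: ler_sum => p _ /=.
  by apply: le_trans (normr_coord _ i ord0); rewrite !mxE.
rewrite (big_nth (0, 0)) big_mkord; apply: h.
- move=> k; have kL : nth (0, 0) L k \in L by rewrite mem_nth.
  have [/andP[-> _] /andP[_ ->]] := Lbc _ kL; split=> //; exact: L1.
- move=> k l kl; move/(pairwiseP (0, 0)) : L2 => L2.
  have [kl'|lk'|/val_inj kl'] := ltngtP k l; last by rewrite kl' eqxx in kl.
    have := L2 k l; rewrite !inE => /(_ (ltn_ord _) (ltn_ord _) kl').
    by rewrite /nonoverlap => /orP[]; [left|right].
  have := L2 l k; rewrite !inE => /(_ (ltn_ord _) (ltn_ord _) lk').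
  by rewrite /nonoverlap => /orP[]; [right|left].
- by move: hl; rewrite /total_length (big_nth (0, 0)) big_mkord.
Qed.

(** An indefinite integral is differentiable at almost every point, with its
    integrand as derivative, so the density is the derivative almost everywhere. *)
Lemma AC_FTC (p : R -> R) (b c : R) : b <= c -> AC (p \o clamp b c) ->
  exists rho : R -> R, [/\ mu.-integrable setT (EFin \o rho),
    forall x, b <= x <= c -> p x - p b = \int[mu]_(t in `]b, x]) rho t &
    {ae mu, forall x, b < x < c -> derivable p x 1 /\ derive1 p x = rho x}].
Proof.
move=> bc acp.
have [rho irho E] := AC_density acp bc (fun x => congr1 p (clamp_max b c x)).
have bb : b <= b <= c by rewrite lexx.
have {}E x : b <= x <= c -> p x - p b = \int[mu]_(t in `]b, x]) rho t.
  by move=> bxc; rewrite -E//= !clamp_id.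
exists rho; split=> //.
have iy y : mu.-integrable [set` Interval (BRight b) (BRight y)] (EFin \o rho).
  exact: (integrableS measurableT).
have loc : locally_integrable setT rho.
  by have := integrable_locally measurableT irho; rewrite patch_setT.
have := FTC1 iy loc; apply: filterS; first exact: (ae_filter_ringOfSetsType mu).
move=> x Hx /andP[bx xc].
have [dF FE] := Hx bx.
have near_eq : {near x, (fun y => \int[mu]_(t in `]b, y]) rho t) + cst (p b) =1 p}.
  near=> y; rewrite /cst/= fctE -E ?subrK//; apply/andP; split; apply/ltW.
    by near: y; exact: lt_nbhsr.
  by near: y; exact: lt_nbhsl.
split; first by apply: near_eq_derivable near_eq _; apply: derivableD.
rewrite derive1E -(near_eq_derive _ near_eq) deriveD// derive_cst addr0.
by rewrite -derive1E FE.
Unshelve. all: by end_near. Qed.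

End AbsolutelyContinuousFTC.

(** * Affine changes of variable *)

Section AffineChange.
Context {R : realType}.
Notation mu := (@lebesgue_measure R).
Implicit Types f : R -> \bar R.

Lemma measurable_affine (c d : R) : measurable_fun [set: R] (fun x => c * x + d).
Proof. by apply: measurable_funD => //; exact: measurable_funM. Qed.

(** Both sides are measures of [A] that agree on half-open intervals. *)
Lemma lebesgue_affine (c d : R) (c0 : 0 < c) (A : set R) : measurable A ->
  mu A = (c%:E * mu ((fun x => (c * x + d)%R) @^-1` A))%E.
Proof.
move=> mA.
pose phi : measurableTypeR R -> measurableTypeR R := fun x => c * x + d.
have mphi : measurable_fun setT phi by exact: measurable_affine.
pose nu0 := mscale (NngNum (ltW c0)) (pushforward mu phi).
pose nu : {measure set (measurableTypeR R) -> \bar R} := nu0 mphi.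
rewrite (lebesgue_measure_unique (mu := nu) _ mA)// => X [[a b] /= _ <-].
have E : phi @^-1` `]a, b] = `](a - d) / c, (b - d) / c]%classic.
  apply/seteqP; split => x /=; rewrite !in_itv /= /phi ltr_pdivrMr// ler_pdivlMr//;
    by rewrite ltrBlDr lerBrDr (mulrC x).
have -> : nu `]a, b]%classic = (c%:E * mu `]((a - d) / c)%R, ((b - d) / c)%R]%classic)%E.
  by rewrite -E.
rewrite !lebesgue_measure_itv /= !lte_fin ltr_pM2r ?invr_gt0// ltrD2r.
case: ifP => ab; last by rewrite mule0.
by rewrite -!EFinB -EFinM; congr EFin; field; rewrite gt_eqF.
Qed.

Lemma ge0_integral_affine (c d : R) f : 0 < c -> measurable_fun setT f ->
  (forall x, (0 <= f x)%E) ->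
  (\int[mu]_x f x = c%:E * \int[mu]_x f (c * x + d)%R)%E.
Proof.
move=> c0 mf f0.
pose phi : measurableTypeR R -> measurableTypeR R := fun x => c * x + d.
have mphi : measurable_fun setT phi by exact: measurable_affine.
pose nu0 := mscale (NngNum (ltW c0)) (pushforward mu phi).
pose nu : {measure set (measurableTypeR R) -> \bar R} := nu0 mphi.
rewrite (eq_measure_integral nu) => [|A mA _]; last exact: lebesgue_affine.
rewrite ge0_integral_mscale//=; congr (_ * _)%E.
by rewrite ge0_integral_pushforward// preimage_setT.
Qed.

(** The positive and negative parts are translated separately, so that it also covers integrals
    that are infinite or of the form oo - oo. *)
Lemma integral_shift (d : R) f : measurable_fun setT f ->
  (\int[mu]_x f (x + d)%R = \int[mu]_x f x)%E.
Proof.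
move=> mf; rewrite [LHS]integralE [RHS]integralE.
rewrite (@ge0_integral_affine 1 d (f^\+)%E)//; last exact: measurable_funepos.
rewrite (@ge0_integral_affine 1 d (f^\-)%E)//; last exact: measurable_funeneg.
rewrite !mul1e; congr (_ - _)%E; apply: eq_integral => x _.
  by rewrite mul1r !funeposE.
by rewrite mul1r !funenegE.
Qed.

Lemma integrable_shift (d : R) f : mu.-integrable setT f ->
  mu.-integrable setT (fun x : R => f (x + d)).
Proof.
move=> /integrableP[mf fi].
have mfd : measurable_fun setT (fun x : R => f (x + d)%R).
  by apply: (measurableT_comp mf); apply: measurable_funD.
apply/integrableP; split=> //.
rewrite (integral_shift d (f := fun x : R => `|f x|%E))//.
exact: measurableT_comp.
Qed.

End AffineChange.

(** * The Gamma function *)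

Section GammaFunction.
Context {R : realType}.
Notation mu := (@lebesgue_measure R).
Implicit Types x a b t : R.

(** The truncation is needed: [t `^ p] is 1, and not 0, for [t < 0]. *)
Definition pow_pos x t : R := if 0 < t then t `^ (x - 1) else 0.

Lemma pow_pos_ge0 x t : 0 <= pow_pos x t.
Proof. by rewrite /pow_pos; case: ifP => // _; exact: powR_ge0. Qed.

Lemma measurable_pow_pos x : measurable_fun [set: R] (pow_pos x).
Proof.
apply: measurable_fun_ifT => //; first exact: measurable_fun_ltr.
Qed.

Lemma pow_posM x c t : 0 < c -> pow_pos x (c * t) = c `^ (x - 1) * pow_pos x t.
Proof.
move=> c0; rewrite /pow_pos pmulr_rgt0//; case: ifP => t0; last by rewrite mulr0.
by rewrite powRM// ltW.
Qed.

Definition gamma_pdf x t : R := pow_pos x t * expR (- t).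

Lemma gamma_pdf_ge0 x t : 0 <= gamma_pdf x t.
Proof. by rewrite mulr_ge0 ?pow_pos_ge0 ?expR_ge0. Qed.

Lemma measurable_gamma_pdf x : measurable_fun [set: R] (gamma_pdf x).
Proof.
apply: measurable_funM; first exact: measurable_pow_pos.
by apply: measurableT_comp => //; exact: oppr_measurable.
Qed.

Lemma GammaE x : Gamma x = fine (\int[mu]_t (gamma_pdf x t)%:E).
Proof.
rewrite /Gamma Rintegral_mkcond /Rintegral; congr fine; apply: eq_integral => t _.
rewrite patchE /gamma_pdf /pow_pos; congr EFin.
case: ifPn => [|]; first by rewrite inE /= in_itv /= andbT => ->.
by rewrite notin_setE /= in_itv /= andbT => /negP/negbTE->; rewrite mul0r.
Qed.

(** Monotone convergence along the intervals [[1 / (n + 2), 1]], on which the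
    integrand has the primitive [t `^ x / x]. *)
Lemma integral_pow01 x : 0 < x ->
  (\int[mu]_(t in `]0%R, 1%R]) (t `^ (x - 1))%:E <= (x^-1)%:E)%E.
Proof.
move=> x0.
pose F (n : nat) : set R := `[n.+2%:R^-1, 1]%classic.
have UF : \bigcup_n F n = `]0, 1]%classic.
  apply/seteqP; split => t /=.
    move=> [n _]; rewrite /F /= !in_itv /= => /andP[h ->].
    by rewrite andbT (lt_le_trans _ h)// invr_gt0.
  rewrite in_itv /= => /andP[t0 t1]; exists (Num.truncn t^-1) => //.
  rewrite /F /= in_itv /= t1 andbT -[leRHS]invrK lef_pV2 ?posrE ?invr_gt0//.
  by apply/ltW/(lt_le_trans (truncnS_gt _)); rewrite ler_nat.
rewrite -UF.
have mp (A : set R) : measurable_fun A (fun t => (t `^ (x - 1))%:E).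
  by apply/measurable_EFinP/measurable_funTS; exact: measurable_powR.
have cv : (\int[mu]_(t in F i) (t `^ (x - 1))%:E @[i --> \oo] -->
    \int[mu]_(t in \bigcup_i F i) (t `^ (x - 1))%:E)%E.
  apply: ge0_nondecreasing_set_cvg_integral => //.
  - move=> m n mn; apply/subsetPset; apply: subset_itvr; rewrite bnd_simp.
    by rewrite lef_pV2 ?posrE// ler_nat.
  - by move=> i; exact: measurable_itv.
  - by move=> i; exact: mp.
  - by move=> i t Ft; rewrite lee_fin powR_ge0.
rewrite -(cvg_lim _ cv)//; apply: lime_le; first by apply/cvg_ex; eexists; exact: cv.
near=> n; rewrite /F.
have n1 : (n.+2%:R)^-1 < 1 :> R by rewrite invf_lt1 ?ltr1n.
have n0 : 0 < (n.+2%:R)^-1 :> R by rewrite invr_gt0.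
have dF t : 0 < t -> is_derive t 1 (fun t => x^-1 * t `^ x) (t `^ (x - 1)).
  move=> t0; have D := is_derive1_powR x t0.
  have -> : t `^ (x - 1) = x^-1 *: (x * t `^ (x - 1)).
    by rewrite /GRing.scale /= mulrA mulVf ?mul1r// gt_eqF.
  exact: is_deriveZ.
rewrite (continuous_FTC2 n1 (F := fun t => x^-1 * t `^ x)).
- rewrite -EFinB lee_fin powR1 mulr1 gerBl mulr_ge0 ?powR_ge0//.
  by rewrite invr_ge0 ltW.
- apply/continuous_in_subspaceT => t; rewrite inE /= in_itv /= => /andP[h _].
  have t0 : 0 < t by exact: lt_le_trans h.
  apply: differentiable_continuous; apply/derivable1_diffP.
  by have [] := is_derive1_powR (x - 1) t0.
- have cF t : 0 < t -> {for t, continuous (fun t => x^-1 * t `^ x)}.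
    move=> t0; apply: differentiable_continuous; apply/derivable1_diffP.
    by have [] := dF t t0.
  split.
  + move=> t; rewrite in_itv /= => /andP[h _].
    by have [] := dF t (lt_trans n0 h).
  + by apply: cvg_at_right_filter; exact: cF.
  + by apply: cvg_at_left_filter; exact: cF.
- move=> t; rewrite in_itv /= => /andP[h _].
  have t0 := lt_trans n0 h.
  by rewrite derive1E; have [_ ->] := dF t t0.
Unshelve. all: by end_near. Qed.

End GammaFunction.

Section GammaFinite.
Context {R : realType}.
Notation mu := (@lebesgue_measure R).
Implicit Types x a b t : R.

(** A power of [t] is at most a multiple of [expR (t / 2)], which leaves one half of
    the exponential decay. *)
Lemma le_gamma_pdf_tail x : exists2 C : R, 0 <= C &
  forall t, 1 < t -> gamma_pdf x t <= C * exponential_pdf (2^-1) t.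
Proof.
pose n := Num.truncn (x - 1); pose c : R := (n.+1)`!%:R.
exists (2 ^+ n.+1 * c * 2); first by rewrite !mulr_ge0.
move=> t t1; have t0 : 0 < t by lra.
rewrite exponential_pdfE ?(ltW t0)// /gamma_pdf /pow_pos t0.
have h1 : t `^ (x - 1) <= t ^+ n.+1.
  rewrite -powR_mulrn ?(ltW t0)//; apply: ler_powR; first exact: ltW.
  exact/ltW/truncnS_gt.
have h2 : t ^+ n.+1 <= 2 ^+ n.+1 * c * expR (t / 2).
  have t20 : 0 <= t / 2 by lra.
  have := expR_ge1Dxn n t20; set e := expR _ => he.
  have c0 : 0 < c by rewrite ltr0n fact_gt0.
  have : (t / 2) ^+ n.+1 <= c * e.
    rewrite -ler_pdivrMl// mulrC; apply: le_trans he.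
    by rewrite lerDr.
  by rewrite expr_div_n ler_pdivrMr ?exprn_gt0// => h; rewrite -mulrA mulrC.
have -> : 2 ^+ n.+1 * c * 2 * (2^-1 * expR (- 2^-1 * t)) =
    2 ^+ n.+1 * c * expR (t / 2) * expR (- t).
  rewrite -[RHS]mulrA -expRD (_ : t / 2 - t = - 2^-1 * t); last by field.
  by field.
by rewrite ler_wpM2r ?expR_ge0// (le_trans h1).
Qed.

Lemma gamma_pdf_lty x : 0 < x -> (\int[mu]_t (gamma_pdf x t)%:E < +oo)%E.
Proof.
move=> x0; have [C C0 HC] := le_gamma_pdf_tail x.
pose f := (fun t => (t `^ (x - 1))%:E) \_ `]0, 1]%classic.
pose g := fun t => (C%:E * (exponential_pdf (2^-1) t)%:E)%E.
have mf : measurable_fun setT f.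
  apply/(measurable_restrictT _ _).1 => //.
  by apply/measurable_EFinP/measurable_funTS; exact: measurable_powR.
have mexp : measurable_fun setT (fun t : R => (exponential_pdf (2^-1) t)%:E).
  by apply/measurable_EFinP; exact: measurable_exponential_pdf.
have mg : measurable_fun setT g by exact: measurable_funeM.
have f0 t : (0 <= f t)%E.
  by rewrite /f patchE; case: ifP => // _; rewrite lee_fin powR_ge0.
have e0 t : 0 <= exponential_pdf (2^-1) t by apply: exponential_pdf_ge0.
have g0 t : (0 <= g t)%E by rewrite mule_ge0 ?lee_fin.
apply: (@le_lt_trans _ _ (\int[mu]_t (f t + g t))%E).
  apply: ge0_le_integral => //.
  - by move=> t _; rewrite lee_fin gamma_pdf_ge0.
  - by apply/measurable_EFinP; exact: measurable_gamma_pdf.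
  - exact: emeasurable_funD.
  - move=> t _; have [t0|t0] := leP t 0.
      rewrite /gamma_pdf /pow_pos ltNge t0 /= mul0r.
      by rewrite adde_ge0.
    have [t1|t1] := leP t 1.
      rewrite -[leLHS]adde0 leeD// /f patchE mem_set /=; last by rewrite in_itv /= t0.
      rewrite lee_fin /gamma_pdf /pow_pos t0 ler_piMr ?powR_ge0//.
      by rewrite -expR0 ler_expR; lra.
    by rewrite -[leLHS]add0e leeD// /g -EFinM lee_fin HC.
rewrite ge0_integralD//; apply: lte_add_pinfty.
  rewrite -integral_mkcond; apply: le_lt_trans (integral_pow01 x0) _.
  exact: ltry.
rewrite (ge0_integralZl mu measurableT mexp) ?lee_fin//; first last.
  by move=> t _; rewrite lee_fin.
by rewrite integral_exponential_pdf// mule1 ltry.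
Qed.

Lemma Gamma_integral x : 0 < x -> (\int[mu]_t (gamma_pdf x t)%:E = (Gamma x)%:E)%E.
Proof.
move=> x0; rewrite GammaE fineK// ge0_fin_numE ?gamma_pdf_lty//.
by apply: integral_ge0 => t _; rewrite lee_fin gamma_pdf_ge0.
Qed.

(** The integral of [gamma_pdf x] is at least its integral over an interval of
    length 1. *)
Lemma Gamma_ge_cst x (L m : R) : 0 < x -> 0 < L ->
  (forall t, L < t <= L + 1 -> m <= t `^ (x - 1) * expR (- t)) -> m <= Gamma x.
Proof.
move=> x0 L0 H; rewrite -lee_fin -Gamma_integral//.
have mL : measurable (`]L, (L + 1)%R]%classic : set (measurableTypeR R)).
  exact: measurable_itv.
apply: le_trans (_ : (\int[mu]_(t in `]L, (L + 1)%R]) (gamma_pdf x t)%:E <= _)%E); last first.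
  apply: ge0_subset_integral => //.
    by apply/measurable_EFinP; exact: measurable_gamma_pdf.
  by move=> t _; rewrite lee_fin gamma_pdf_ge0.
have -> : (m%:E = \int[mu]_(t in `]L, (L + 1)%R]) m%:E)%E.
  rewrite integral_cst; last exact: measurable_itv.
  rewrite /= lebesgue_measure_itv /= lte_fin ltrDl ltr01 -EFinB.
  by rewrite addrAC subrr add0r mule1.
have [m0|m0] := leP 0 m; last first.
  apply: (@le_trans _ _ 0%E).
    rewrite integral_cst; last exact: measurable_itv.
    by rewrite mule_le0_ge0// lee_fin ltW.
  by apply: integral_ge0 => t _; rewrite lee_fin gamma_pdf_ge0.
apply: ge0_le_integral => //.
- by apply/measurable_EFinP/measurable_funTS; exact: measurable_gamma_pdf.
- move=> t; rewrite /= in_itv /= => /andP[Lt tL].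
  rewrite lee_fin /gamma_pdf /pow_pos (lt_trans L0 Lt); apply: H.
  by rewrite Lt.
Qed.

(** Integrating over [ ]L, L + 1] ] alone suffices; as [L] is arbitrary, Gamma
    outgrows every geometric progression. *)
Lemma Gamma_growth x (L : R) : 1 <= x -> 0 < L ->
  L `^ (x - 1) * expR (- (L + 1)) <= Gamma x.
Proof.
move=> x1 L0; apply: (Gamma_ge_cst (L := L)) => //; first lra.
move=> t /andP[Lt tL]; apply: ler_pM; rewrite ?powR_ge0 ?expR_ge0//.
  by apply: ge0_ler_powR; rewrite ?nnegrE; lra.
by rewrite ler_expR; lra.
Qed.

Lemma Gamma_gt0 x : 0 < x -> 0 < Gamma x.
Proof.
move=> x0; have [x1|x1] := leP 1 x.
  by apply: lt_le_trans (Gamma_growth x1 ltr01); rewrite powR1 mul1r expR_gt0.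
apply: (@lt_le_trans _ _ (2 `^ (x - 1) * expR (- 2))).
  by rewrite mulr_gt0 ?expR_gt0// powR_gt0.
apply: (Gamma_ge_cst (L := 1)) => // t /andP[Lt tL].
apply: ler_pM; rewrite ?powR_ge0 ?expR_ge0//; last by rewrite ler_expR; lra.
have t0 : 0 < t by lra.
rewrite -[x - 1]opprK powRN [leRHS]powRN lef_pV2 ?posrE ?powR_gt0//.
apply: ge0_ler_powR; rewrite ?nnegrE; [lra|lra|lra|].
by apply: le_trans tL _; lra.
Qed.

Lemma Gamma1 : Gamma 1 = 1 :> R.
Proof.
apply: EFin_inj; rewrite -Gamma_integral// -[in RHS](@integral_exponential_pdf R 1)//.
apply: ae_eq_integral => //.
- by apply/measurable_EFinP; exact: measurable_gamma_pdf.
- by apply/measurable_EFinP; exact: measurable_exponential_pdf.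
exists [set 0]; split.
- exact: measurable_set1.
- exact: lebesgue_measure_set1.
move=> t /= h; apply: contrapT => t0; apply: h => _; congr EFin.
rewrite /gamma_pdf /pow_pos; case: ltP => [tp|tn].
  by rewrite exponential_pdfE ?ltW// subrr powRr0 !mul1r mulN1r.
rewrite mul0r lt0_exponential_pdf// lt_neqAle tn andbT; exact/eqP.
Qed.

End GammaFinite.

(** * Riemann-Liouville kernels *)

Section RLKernel.
Context {R : realType}.
Notation mu := (@lebesgue_measure R).
Implicit Types x a b t : R.

Let B a b : \bar R := (\int[mu]_r (pow_pos a (1 - r) * pow_pos b r)%:E)%E.

Lemma measurable_pow_pos_sub a t : measurable_fun [set: R] (fun s => pow_pos a (t - s)).
Proof.
apply: (measurableT_comp (measurable_pow_pos a)).
exact: measurable_funB.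
Qed.

(** Substitute [t * s] for [s]: both factors are homogeneous. *)
Lemma integral_pow_pos_conv a b t : 0 < t ->
  (\int[mu]_s (pow_pos a (t - s) * pow_pos b s)%:E = (t `^ (a + b - 1))%:E * B a b)%E.
Proof.
move=> t0.
have mint u : measurable_fun setT (fun s : R => (pow_pos a (u - s) * pow_pos b s)%:E).
  apply/measurable_EFinP/measurable_funM; first exact: measurable_pow_pos_sub.
  exact: measurable_pow_pos.
rewrite (@ge0_integral_affine _ t 0)//; last first.
  by move=> s; rewrite lee_fin mulr_ge0 ?pow_pos_ge0.
have -> : (\int[mu]_s (pow_pos a (t - (t * s + 0)) * pow_pos b (t * s + 0))%:E =
   \int[mu]_s ((t `^ (a - 1) * t `^ (b - 1))%:E * (pow_pos a (1 - s) * pow_pos b s)%:E))%E.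
  apply: eq_integral => s _; rewrite addr0 -{1}[t]mulr1 -mulrBr !pow_posM//.
  by rewrite -EFinM; congr EFin; rewrite mulrACA.
rewrite ge0_integralZl//; first last.
- by rewrite lee_fin mulr_ge0 ?powR_ge0.
- by move=> s _; rewrite lee_fin mulr_ge0 ?pow_pos_ge0.
- exact: mint.
rewrite muleA -EFinM; congr (_%:E * _)%E.
have tn0 : t != 0 by rewrite gt_eqF.
by rewrite -{1}(powRr1 (ltW t0)) -!powRD ?tn0 ?implybT//; congr powR; ring.
Qed.

Lemma conv_pow_pos_npos a b t s : t <= 0 -> pow_pos a (t - s) * pow_pos b s = 0.
Proof.
move=> t0; rewrite /pow_pos; case: (ltP 0 s) => s0; last by rewrite mulr0.
by case: ltP => [|_]; [lra|rewrite mul0r].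
Qed.

(** Integrate [gamma_pdf a (x - y) * gamma_pdf b y] over the plane.  In the order
    [x], [y] the integral factors.  In the order [y], [x] the two exponentials
    merge into [expR (- x)] and homogeneity of the powers leaves the Beta integral
    times [gamma_pdf (a + b) x]. *)
Lemma beta_gamma a b : 0 < a -> 0 < b ->
  (B a b * (Gamma (a + b))%:E = (Gamma a * Gamma b)%:E)%E.
Proof.
move=> a0 b0.
have mg c : measurable_fun setT (fun s : R => (gamma_pdf c s)%:E).
  by apply/measurable_EFinP; exact: measurable_gamma_pdf.
pose f (z : R * R) := ((gamma_pdf a (z.1 - z.2) * gamma_pdf b z.2)%:E)%E.
have mf : measurable_fun setT f.
  apply/measurable_EFinP/measurable_funM.
    apply: (measurableT_comp (measurable_gamma_pdf a)).
    by apply: measurable_funB.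
  by apply: (measurableT_comp (measurable_gamma_pdf b)).
have f0 z : (0 <= f z)%E by rewrite lee_fin mulr_ge0 ?gamma_pdf_ge0.
have := @fubini_tonelli _ _ _ _ R mu mu f mf f0.
have -> : (\int[mu]_y \int[mu]_x f (x, y) = (Gamma a * Gamma b)%:E)%E.
  transitivity (\int[mu]_y ((Gamma a)%:E * (gamma_pdf b y)%:E))%E.
    apply: eq_integral => y _.
    rewrite -(@integral_shift _ y); last first.
      exact: (measurableT_comp mf (pair2_measurable y)).
    under eq_integral do rewrite /f /= addrK mulrC EFinM.
    rewrite (ge0_integralZl mu measurableT (mg a)) ?lee_fin ?gamma_pdf_ge0//; last first.
      by move=> s _; rewrite lee_fin gamma_pdf_ge0.
    by rewrite muleC Gamma_integral.
  rewrite (ge0_integralZl mu measurableT (mg b)) ?lee_fin ?(ltW (Gamma_gt0 a0))//.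
    by rewrite Gamma_integral// EFinM.
  by move=> s _; rewrite lee_fin gamma_pdf_ge0.
move=> <-.
have B0 : (0 <= B a b)%E.
  by apply: integral_ge0 => r _; rewrite lee_fin mulr_ge0 ?pow_pos_ge0.
transitivity (\int[mu]_v (B a b * (gamma_pdf (a + b) v)%:E))%E.
  rewrite (ge0_integralZl mu measurableT (mg (a + b)))//; last first.
    by move=> s _; rewrite lee_fin gamma_pdf_ge0.
  by rewrite Gamma_integral// addr_gt0.
apply: eq_integral => v _.
have -> : (\int[mu]_y f (v, y) =
   \int[mu]_y ((expR (- v))%:E * (pow_pos a (v - y) * pow_pos b y)%:E))%E.
  apply: eq_integral => y _; rewrite /f /= /gamma_pdf -EFinM; congr EFin.
  rewrite (_ : expR (- v) = expR (- (v - y)) * expR (- y)); first by ring.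
  by rewrite -expRD; congr expR; ring.
rewrite ge0_integralZl ?lee_fin ?expR_ge0//; first last.
- by move=> y _; rewrite lee_fin mulr_ge0 ?pow_pos_ge0.
- apply/measurable_EFinP/measurable_funM; first exact: measurable_pow_pos_sub.
  exact: measurable_pow_pos.
have [v0|v0] := leP v 0.
  rewrite integral0_eq; last by move=> y _; rewrite conv_pow_pos_npos.
  by rewrite mule0 /gamma_pdf /pow_pos ltNge v0 /= mul0r mule0.
rewrite integral_pow_pos_conv// muleA -EFinM muleC.
by rewrite /gamma_pdf /pow_pos v0 mulrC.
Qed.

(** Convolution with this kernel is the fractional integral of order [a] from 0, for
    functions that vanish on the negative half-line. *)
Definition rl_kernel a t : R := pow_pos a t / Gamma a.

Lemma rl_kernel_ge0 a t : 0 < a -> 0 <= rl_kernel a t.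
Proof. by move=> a0; rewrite divr_ge0 ?pow_pos_ge0 ?ltW ?Gamma_gt0. Qed.

Lemma measurable_rl_kernel a : measurable_fun [set: R] (rl_kernel a).
Proof. by apply: measurable_funM => //; exact: measurable_pow_pos. Qed.

Lemma rl_kernel_npos a t : t <= 0 -> rl_kernel a t = 0.
Proof. by move=> t0; rewrite /rl_kernel /pow_pos ltNge t0 mul0r. Qed.

Lemma rl_kernelE a t : 0 < t -> rl_kernel a t = t `^ (a - 1) / Gamma a.
Proof. by move=> t0; rewrite /rl_kernel /pow_pos t0. Qed.

Lemma rl_kernel1 t : 0 < t -> rl_kernel 1 t = 1.
Proof. by move=> t0; rewrite rl_kernelE// subrr powRr0 Gamma1 divr1. Qed.

Lemma rl_kernel_conv a b t : 0 < a -> 0 < b ->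
  (\int[mu]_s (rl_kernel a (t - s) * rl_kernel b s)%:E = (rl_kernel (a + b) t)%:E)%E.
Proof.
move=> a0 b0.
have G0 c : 0 < c -> Gamma c != 0 :> R by move=> c0; rewrite gt_eqF ?Gamma_gt0.
have ab0 := addr_gt0 a0 b0.
under eq_integral do rewrite /rl_kernel mulrACA -invfM mulrC EFinM.
rewrite ge0_integralZl//; first last.
- by rewrite lee_fin invr_ge0 mulr_ge0 ?ltW ?Gamma_gt0.
- by move=> s _; rewrite lee_fin mulr_ge0 ?pow_pos_ge0.
- apply/measurable_EFinP/measurable_funM; first exact: measurable_pow_pos_sub.
  exact: measurable_pow_pos.
have [t0|t0] := leP t 0.
  rewrite integral0_eq; last by move=> y _; rewrite conv_pow_pos_npos.
  by rewrite mule0 rl_kernel_npos.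
rewrite integral_pow_pos_conv//.
have -> : B a b = (Gamma a * Gamma b / Gamma (a + b))%:E.
  have := beta_gamma a0 b0.
  have : (0 <= B a b)%E.
    by apply: integral_ge0 => r _; rewrite lee_fin mulr_ge0 ?pow_pos_ge0.
  case: (B a b) => [r _| _|//].
    by rewrite -EFinM => -[<-]; rewrite mulfK// G0.
  by rewrite gt0_mulye// lte_fin Gamma_gt0.
rewrite -!EFinM rl_kernelE//; congr EFin; field.
by rewrite !G0.
Qed.

#[global] Opaque rl_kernel.

Lemma rl_kernel_nd a s t : 1 <= a -> s <= t -> rl_kernel a s <= rl_kernel a t.
Proof.
move=> a1 st; have a0 : 0 < a by lra.
have [s0|s0] := leP s 0; first by rewrite rl_kernel_npos// rl_kernel_ge0.
have t0 : 0 < t by lra.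
rewrite !rl_kernelE// ler_pM2r ?invr_gt0 ?Gamma_gt0//.
by apply: ge0_ler_powR; rewrite ?nnegrE; lra.
Qed.

End RLKernel.

(** * Convolution on the half-line *)

Section Convolution.
Context {R : realType}.
Notation mu := (@lebesgue_measure R).
Implicit Types (a b t : R) (f k u v : R -> R).

Lemma eq_lebesgue_integral (f g : R -> \bar R) : f =1 g ->
  (\int[mu]_x f x = \int[mu]_x g x)%E.
Proof. by move=> fg; apply: eq_integral => x _; rewrite fg. Qed.

Definition rintegrable f : Prop := mu.-integrable setT (EFin \o f).

Lemma rintegrable_measurable f : rintegrable f -> measurable_fun setT f.
Proof. by move=> /integrableP[/measurable_EFinP]. Qed.

Lemma rintegrableP f : measurable_fun setT f ->
  (\int[mu]_x `|f x|%:E < +oo)%E -> rintegrable f.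
Proof. by move=> mf fi; apply/integrableP; split => //; exact/measurable_EFinP. Qed.

Lemma rintegrable_le f v : measurable_fun setT f -> (forall x, `|f x| <= `|v x|) ->
  rintegrable v -> rintegrable f.
Proof.
move=> mf fv; apply: le_integrable => //; first exact/measurable_EFinP.
by move=> x _; rewrite /= lee_fin.
Qed.

Lemma rintegrableD f v : rintegrable f -> rintegrable v -> rintegrable (fun x => f x + v x).
Proof. exact: integrableD. Qed.

Lemma rintegrableZ c f : rintegrable f -> rintegrable (fun x => c * f x).
Proof. exact: integrableZl. Qed.

Lemma rintegrable_sum (I : finType) (F : I -> R -> R) : (forall i, rintegrable (F i)) ->
  rintegrable (fun x => \sum_i F i x).
Proof.
move=> sF; rewrite /rintegrable (_ : EFin \o _ = fun x => \sum_i (F i x)%:E)%E.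
  by apply: integrable_sum => // i _; exact: sF.
by apply/funext => x /=; rewrite sumEFin.
Qed.

Lemma rintegrable_shift h f : rintegrable f -> rintegrable (fun x => f (x - h)).
Proof. exact: (@integrable_shift _ (- h)). Qed.

Lemma Rintegral_shift h f : measurable_fun setT f ->
  \int[mu]_x f (x - h) = \int[mu]_x f x.
Proof.
move=> mf; rewrite /Rintegral; congr fine.
by rewrite -(@integral_shift _ (- h) (EFin \o f))//; exact/measurable_EFinP.
Qed.

Lemma Rintegral_ae f v : measurable_fun setT f -> measurable_fun setT v ->
  {ae mu, forall x, f x = v x} -> \int[mu]_x f x = \int[mu]_x v x.
Proof.
move=> mf mv fv; rewrite /Rintegral; congr fine.
apply: ae_eq_integral => //; [exact/measurable_EFinP|exact/measurable_EFinP|].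
move: fv; apply: filterS; first exact: (ae_filter_ringOfSetsType mu).
by move=> x /= ->.
Qed.

Lemma Rintegral_sum (I : finType) (F : I -> R -> R) : (forall i, rintegrable (F i)) ->
  \int[mu]_x (\sum_i F i x) = \sum_i \int[mu]_x F i x.
Proof.
move=> sF; rewrite /Rintegral; under eq_integral do rewrite -sumEFin.
rewrite integral_sum//.
apply/esym/sum_fine => i _; apply: integrable_fin_num => //; exact: sF.
Qed.

Definition conv k u t : R := \int[mu]_s (k (t - s) * u s).

Lemma measurable_conv_integrand k u t : measurable_fun setT k ->
  measurable_fun setT u -> measurable_fun setT (fun s : R => k (t - s) * u s).
Proof.
move=> mk mu'; apply: measurable_funM => //.
by apply: (measurableT_comp mk); apply: measurable_funB.
Qed.

(** [conv k u] is everywhere the difference of the partial integrals of the positive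
    and negative parts of the integrand, and both are measurable by Tonelli. *)
Lemma measurable_conv k u : measurable_fun setT k -> measurable_fun setT u ->
  measurable_fun setT (conv k u).
Proof.
move=> mk mu'; pose f (z : R * R) := (k (z.1 - z.2) * u z.2)%:E.
have mf : measurable_fun setT f.
  apply/measurable_EFinP/measurable_funM.
    by apply: (measurableT_comp mk); apply: measurable_funB.
  exact: (measurableT_comp mu').
have mp := measurable_funepos mf; have mn := measurable_funeneg mf.
have Hp : measurable_fun setT (fubini_F mu (f^\+)%E).
  by apply: measurable_fun_fubini_tonelli_F => // z; exact: funepos_ge0.
have Hn : measurable_fun setT (fubini_F mu (f^\-)%E).
  by apply: measurable_fun_fubini_tonelli_F => // z; exact: funeneg_ge0.
have H := emeasurable_funB Hp Hn.
rewrite (_ : conv k u = fine \o (fubini_F mu (f^\+)%E \- fubini_F mu (f^\-)%E)%E).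
  by apply: measurableT_comp => //; exact: fine_measurable.
apply/funext => t; rewrite /conv /Rintegral /=; congr fine.
rewrite integralE /fubini_F; congr (_ - _)%E; apply: eq_integral => s _.
  by rewrite !funeposE.
by rewrite !funenegE.
Qed.

Lemma conv_shift k u h t : measurable_fun setT k -> measurable_fun setT u ->
  conv k (fun s => u (s - h)) t = conv k u (t - h).
Proof.
move=> mk mu'; rewrite /conv.
rewrite -(Rintegral_shift h (measurable_conv_integrand _ mk mu')).
by apply: eq_Rintegral => s _; congr (k _ * _); lra.
Qed.

Notation ker := rl_kernel.

Definition causal u : Prop := forall s, s <= 0 -> u s = 0.

(** A kernel of order at least 1 is nondecreasing, hence bounded by its value at
    [t] on the part of the line where [u] lives. *)
Lemma conv_bound a u t s : 1 <= a -> causal u ->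
  `|ker a (t - s) * u s| <= `|ker a t * u s|.
Proof.
move=> a1 cu; have a0 : 0 < a by lra.
have [s0|s0] := leP s 0; first by rewrite cu// !mulr0.
rewrite [leLHS]normrM [leRHS]normrM; apply: ler_wpM2r => //.
by rewrite !ger0_norm ?rl_kernel_ge0//; apply: rl_kernel_nd => //; lra.
Qed.

Lemma conv_rintegrable a u t : 1 <= a -> rintegrable u -> causal u ->
  rintegrable (fun s => ker a (t - s) * u s).
Proof.
move=> a1 su cu; apply: (@rintegrable_le _ (fun s => ker a t * u s)).
- by apply: measurable_conv_integrand; [exact: measurable_rl_kernel|exact: rintegrable_measurable].
- by move=> s; exact: conv_bound.
- exact: rintegrableZ.
Qed.

Lemma conv_norm_le a u t : 1 <= a -> rintegrable u -> causal u ->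
  `|conv (ker a) u t| <= ker a t * \int[mu]_s `|u s|.
Proof.
move=> a1 su cu; have a0 : 0 < a by lra.
have sun : rintegrable (fun s => `|u s|) by exact: (integrable_abse su).
rewrite -RintegralZl//.
apply: le_trans (le_normr_Rintegral _ (conv_rintegrable t a1 su cu)) _ => //.
apply: le_Rintegral => //; first exact: (integrable_abse (conv_rintegrable t a1 su cu)).
  exact: rintegrableZ.
move=> s _; apply: le_trans (conv_bound _ _ a1 cu) _.
by rewrite normrM ger0_norm// rl_kernel_ge0.
Qed.

Lemma conv_kernels a b t : 0 < a -> 0 < b -> conv (ker a) (ker b) t = ker (a + b) t.
Proof. by move=> a0 b0; rewrite /conv /Rintegral rl_kernel_conv. Qed.

Lemma conv_kernels_rintegrable a b t : 0 < a -> 0 < b ->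
  rintegrable (fun s => ker a (t - s) * ker b s).
Proof.
move=> a0 b0; apply: rintegrableP.
  by apply: measurable_conv_integrand; exact: measurable_rl_kernel.
rewrite (@eq_lebesgue_integral _ (fun s : R => (ker a (t - s) * ker b s)%:E)); last first.
  by move=> s; rewrite ger0_norm// mulr_ge0// rl_kernel_ge0.
by rewrite rl_kernel_conv// ltry.
Qed.

Lemma conv_causal k u : causal k -> causal u -> causal (conv k u).
Proof.
move=> ck cu t t0; rewrite /conv (@eq_Rintegral _ _ _ _ _ (fun=> 0)) ?Rintegral_cst ?mul0r//.
move=> s _; have [s0|s0] := leP s 0; first by rewrite cu// mulr0.
by rewrite ck ?mul0r//; lra.
Qed.

Lemma causal_ker a : causal (ker a).
Proof. by move=> t; exact: rl_kernel_npos. Qed.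

(** Fubini.  The order [a + b >= 1] makes the convolution of the two kernels bounded
    near 0, so that the double integral converges absolutely for every [t], and not
    only for almost every [t]. *)
Lemma conv_semigroup a b u t : 0 < a -> 0 < b -> 1 <= a + b -> rintegrable u ->
  causal u ->
  rintegrable (fun s => ker a (t - s) * conv (ker b) u s) /\
  conv (ker a) (conv (ker b) u) t = conv (ker (a + b)) u t.
Proof.
move=> a0 b0 ab1 su cu; have mu' := rintegrable_measurable su.
have mk c := @measurable_rl_kernel R c.
pose f (z : R * R) := (ker a (t - z.1) * (ker b (z.1 - z.2) * u z.2))%:E.
have mf : measurable_fun setT f.
  apply/measurable_EFinP/measurable_funM.
    by apply: (measurableT_comp (mk a)); apply: measurable_funB.
  apply: measurable_funM; last exact: (measurableT_comp mu').
  by apply: (measurableT_comp (mk b)); apply: measurable_funB.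
have inner r : (\int[mu]_s (ker a (t - s) * ker b (s - r))%:E =
    (ker (a + b) (t - r))%:E)%E.
  rewrite -rl_kernel_conv// -(@integral_shift _ (- r)
    (fun s : R => (ker a (t - r - s) * ker b s)%:E)); last first.
    by apply/measurable_EFinP; exact: (measurable_conv_integrand (t - r) (mk a) (mk b)).
  by apply: eq_integral => s _; congr (_%:E); congr (ker a _ * _); lra.
have mab r : measurable_fun setT (fun s : R => (ker a (t - s) * ker b (s - r))%:E).
  apply/measurable_EFinP/measurable_funM.
    by apply: (measurableT_comp (mk a)); apply: measurable_funB.
  by apply: (measurableT_comp (mk b)); apply: measurable_funB.
have hr r : rintegrable (fun s => ker a (t - s) * ker b (s - r)).
  apply: rintegrableP; first by have /measurable_EFinP := mab r.
  rewrite (@eq_lebesgue_integral _ (fun s : R => (ker a (t - s) * ker b (s - r))%:E)).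
    by rewrite inner ltry.
  by move=> s /=; rewrite ger0_norm// mulr_ge0// rl_kernel_ge0.
have int_f : (mu \x mu)%E.-integrable setT f.
  apply: (integrable21ltyP mu mu mf).2.
  rewrite (@eq_lebesgue_integral _ (fun r : R => `|ker (a + b) (t - r) * u r|%:E)); last first.
    move=> r.
    rewrite (@eq_lebesgue_integral _ (fun s : R => (`|u r|%:E * (ker a (t - s) * ker b (s - r))%:E)%E)).
      rewrite (ge0_integralZl mu measurableT (mab r))//.
        by rewrite inner -EFinM normrM (ger0_norm (rl_kernel_ge0 _ _)) 1?mulrC//; lra.
      by move=> s _; rewrite lee_fin mulr_ge0 ?rl_kernel_ge0.
    move=> s; rewrite /f /= -EFinM; congr EFin.
    rewrite [LHS]normrM (ger0_norm (rl_kernel_ge0 _ a0)).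
    by rewrite [X in _ * X]normrM (ger0_norm (rl_kernel_ge0 _ b0)); ring.
  by have /integrableP[_] := conv_rintegrable t ab1 su cu.
have mconv : measurable_fun setT (fun s : R => ker a (t - s) * conv (ker b) u s).
  by apply: measurable_conv_integrand => //; exact: measurable_conv.
(* where [ker a (t - s)] is not 0 it can be divided out, so that the inner integral converges *)
have ae_eq_f : ae_eq mu setT (fubini_F mu f)
    (EFin \o (fun s => ker a (t - s) * conv (ker b) u s)).
  have := ae_integrable1 int_f; apply: filterS.
  move=> s /= hs _; rewrite /fubini_F /f /=.
  have [k0|k0] := eqVneq (ker a (t - s)) 0.
    by rewrite k0 mul0r integral0_eq// => r _; rewrite mul0r.
  have hs' : rintegrable (fun r => ker b (s - r) * u r).
    have := rintegrableZ (ker a (t - s))^-1 hs.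
    by rewrite /rintegrable; congr integrable; apply/funext => r /=; rewrite mulKf.
  under eq_integral do rewrite EFinM.
  rewrite integralZl//= /conv /Rintegral [RHS]EFinM fineK//.
  exact: integrable_fin_num.
have int_conv : rintegrable (fun s => ker a (t - s) * conv (ker b) u s).
  apply/integrableP; split; first exact/measurable_EFinP.
  have /integrableP[_] := integrable_fubini_F int_f; apply: le_lt_trans.
  rewrite le_eqVlt; apply/orP; left; apply/eqP; apply: ae_eq_integral => //.
  - by apply: measurableT_comp => //; exact/measurable_EFinP.
  - by apply: measurableT_comp => //; exact: (measurable_fubini_F int_f).
  - move: ae_eq_f; apply: filterS.
    by move=> s hs _; rewrite /= -abse_EFin; congr (`|_|)%E; exact/esym/hs.
split=> //; rewrite {1}/conv /Rintegral.
have mconvE : measurable_fun setT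
    (EFin \o (fun s : R => ker a (t - s) * conv (ker b) u s)).
  exact/measurable_EFinP.
rewrite -(@ae_eq_integral _ _ _ mu _ _ _ measurableT (measurable_fubini_F int_f) mconvE ae_eq_f).
rewrite integral12_prod_meas1// -integral21_prod_meas1// /conv /Rintegral.
congr fine; apply: eq_integral => r _; rewrite /fubini_G /f /=.
rewrite (@eq_lebesgue_integral _ (fun s : R => ((u r)%:E * (ker a (t - s) * ker b (s - r))%:E)%E)).
  by rewrite (integralZl measurableT (hr r)) /= inner -EFinM mulrC.
by move=> s; rewrite -EFinM; congr EFin; ring.
Qed.

End Convolution.

(** * Taylor's formula of order two *)

Section Order2.
Context {R : realType}.
Notation mu := (@lebesgue_measure R).
Notation ker := rl_kernel.
Implicit Types (a b t : R) (f k u v : R -> R).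

Lemma conv_kernel1 u t : causal u -> conv (ker 1) u t = \int[mu]_(s in `]0, t[) u s.
Proof.
move=> cu; rewrite Rintegral_mkcond /conv; apply: eq_Rintegral => s _.
rewrite patchE; case: ifPn => [|].
  by rewrite inE /= in_itv /= => /andP[s0 st]; rewrite rl_kernel1 ?mul1r// subr_gt0.
rewrite notin_setE /= in_itv /= => /negP; rewrite negb_and -!leNgt => /orP[s0|ts].
  by rewrite cu// mulr0.
by rewrite rl_kernel_npos ?mul0r// subr_le0.
Qed.

Lemma rintegrable_itv (i : interval R) u : rintegrable u ->
  mu.-integrable [set` i] (EFin \o u).
Proof. by move=> ?; apply: (integrableS measurableT) => //; exact: measurable_itv. Qed.

Lemma conv_kernel1_cc u t : rintegrable u -> causal u ->
  conv (ker 1) u t = \int[mu]_(s in `[0, t]) u s.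
Proof.
move=> su cu; rewrite conv_kernel1// Rintegral_itv_bndo_bndc; last exact: rintegrable_itv.
by rewrite Rintegral_itv_obnd_cbnd//; exact: rintegrable_itv.
Qed.

(** The derivative [p] is the integral of [q] on every [[b, t]] with [b > 0]; as [q]
    is integrable up to 0, the limit [b --> 0] gives [p = a1 + I^1 q], which is
    continuous and can be integrated once more. *)
Lemma taylor2 (g p q : R -> R) (T a0 a1 : R) :
  (forall t, 0 < t < T -> is_derive t 1 g (p t)) ->
  (forall b c, 0 < b -> b <= c -> c < T -> AC (p \o clamp b c)) ->
  rintegrable q -> causal q ->
  (forall b c, 0 < b -> b <= c -> c < T ->
    {ae mu, forall t, b < t < c -> derive1 p t = q t}) ->
  g t @[t --> 0^'+] --> a0 -> p t @[t --> 0^'+] --> a1 ->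
  forall t, 0 < t < T -> g t = a0 + a1 * t + conv (ker 2) q t.
Proof.
move=> dg acp iq cq dp g0 p0.
have pE t : 0 < t < T -> p t = a1 + conv (ker 1) q t.
  move=> /andP[t0 tT].
  have step b : 0 < b -> b <= t -> p b = p t - conv (ker 1) q t + \int[mu]_(s in `[0, b]) q s.
    move=> b0 bt.
    have [rho [irho E D]] := AC_FTC bt (acp b t b0 bt tT).
    have -> : p b = p t - (p t - p b) by lra.
    rewrite E ?bt ?lexx// conv_kernel1_cc//.
    have -> : \int[mu]_(s in `]b, t]) rho s = \int[mu]_(s in `]b, t]) q s.
      rewrite -Rintegral_itv_bndo_bndc; last exact: rintegrable_itv.
      rewrite -Rintegral_itv_bndo_bndc; last exact: rintegrable_itv.
      rewrite /Rintegral; congr fine; apply: ae_eq_integral => //.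
      - by apply: measurable_funTS; have /integrableP[] := irho.
      - by apply: measurable_funTS; have /integrableP[] := iq.
      have D' := dp b t b0 bt tT.
      apply: (@filterS2 _ _ (ae_filter_ringOfSetsType mu) _ _ _ _ D D').
      move=> s /= Hs qs; rewrite in_itv /= => sbt; congr EFin.
      by have [_ <-] := Hs sbt; exact: qs.
    have := @Rintegral_itvB R q (BLeft 0) (BRight t) b.
    rewrite !bnd_simp => /(_ (rintegrable_itv _ iq) (ltW b0) bt) <-.
    by lra.
  have lim1 : p b @[b --> 0^'+] --> p t - conv (ker 1) q t.
    have lim1' : p t - conv (ker 1) q t + \int[mu]_(s in `[0, b]) q s @[b --> 0^'+]
        --> p t - conv (ker 1) q t + 0.
      apply: cvgD; first exact: cvg_cst.
      apply: cvg_at_right_filter.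
      exact: (@parameterized_integral_cvg_left R 0 t q t0 (rintegrable_itv _ iq)).
    rewrite addr0 in lim1'; apply: cvg_trans lim1'; apply: near_eq_cvg; near=> b.
    have [b0 bt] : 0 < b /\ b <= t by split; near: b; [exact: nbhs_right_gt|exact: nbhs_right_le].
    by rewrite [RHS]step.
  have := cvg_unique _ p0 lim1 => /(_ (@Rhausdorff R)) ->; lra.
move=> t /andP[t0 tT].
have -> : conv (ker 2) q t = conv (ker 1) (conv (ker 1) q) t.
  have [] := @conv_semigroup R 1 1 q t; rewrite ?ltr01//; lra.
rewrite conv_kernel1; last by apply: conv_causal => //; exact: causal_ker.
pose J (s : R) : R := \int[mu]_(x in `[0, s]) q x.
have ccont : {within `[0, t], continuous J}.
  exact: (@parameterized_integral_continuous R 0 t q (ltW t0) (rintegrable_itv _ iq)).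
(* [g] extended to 0 by its limit, whatever the value of [g] at 0 *)
pose g' (s : R) := if 0 < s then g s else a0.
have g'E (s : R) : 0 < s -> {near s, g =1 g'}.
  by move=> s0; near=> r; rewrite /g' ifT//; near: r; exact: lt_nbhsr.
have D (s : R) : 0 < s < T -> derivable g' s 1 /\ derive1 g' s = p s.
  move=> sT; have s0 : 0 < s by case/andP: sT.
  have [ds ps] := dg s sT; split; first exact: near_eq_derivable (g'E s s0) _.
  by rewrite derive1E -(near_eq_derive _ (g'E s s0)).
have fcont : {within `[0, t], continuous (fun s => a1 + J s)}.
  by move=> s; apply: cvgD; [exact: cvg_cst|exact: ccont].
have FTC := @continuous_FTC2 R _ g' 0 t t0 fcont.
have {FTC} : (\int[mu]_(x in `[0%R, t]) (a1 + J x)%R%:E =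
    (g' t)%:E - (g' 0%R)%:E)%E.
  apply: FTC.
    split.
    - move=> s; rewrite in_itv /= => /andP[s0 st]; apply: (D s _).1; lra.
    - rewrite [X in _ --> X](_ : _ = a0); last by rewrite /g' ltxx.
      apply: cvg_trans g0; apply: near_eq_cvg; near=> r; rewrite /g' ifT//.
    - apply: cvg_at_left_filter; apply: differentiable_continuous.
      by apply/derivable1_diffP; apply: (D t _).1; rewrite t0.
  move=> s; rewrite in_itv /= => /andP[s0 st].
  by rewrite (D s _).2 ?pE ?conv_kernel1_cc//; lra.
rewrite /g' t0 ltxx => FTC.
have {FTC} : \int[mu]_(x in `[0, t]) (a1 + J x) = g t - a0.
  by rewrite /Rintegral FTC.
have iJ : mu.-integrable `[0, t] (EFin \o J).
  by apply: continuous_compact_integrable => //; exact: segment_compact.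
have i1 : mu.-integrable `[0, t] (EFin \o cst a1).
  apply: continuous_compact_integrable; first exact: segment_compact.
  by apply: continuous_subspaceT => x; exact: cvg_cst.
rewrite RintegralD//= Rintegral_cst//= lebesgue_measure_itv /= lte_fin t0 sube0 /=.
have -> : \int[mu]_(s in `]0, t[) conv (ker 1) q s = \int[mu]_(s in `[0, t]) J s.
  rewrite -Rintegral_itv_obnd_cbnd; last first.
    by apply: integrableS iJ => //; apply: subset_itvr; rewrite bnd_simp.
  rewrite -Rintegral_itv_bndo_bndc; last first.
    by apply: integrableS iJ => //; apply: subset_itv; rewrite bnd_simp.
  by apply: eq_Rintegral => s _; rewrite conv_kernel1_cc.
by lra.
Unshelve. all: by end_near. Qed.

End Order2.

(** * From the fractional equation to a Volterra equation *)

Section Inversion.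
Context {R : realType}.
Notation mu := (@lebesgue_measure R).
Notation ker := rl_kernel.
Implicit Types (a b t : R) (f k u v : R -> R).

(** The identity is the member of order 0 of the convolution semigroup, but no
    function is its kernel. *)
Definition frac_conv gamma u : R -> R := if gamma == 0 then u else conv (ker gamma) u.

Lemma causal_frac_conv gamma u : causal u -> causal (frac_conv gamma u).
Proof.
move=> cu; rewrite /frac_conv; case: ifP => // _.
by apply: conv_causal => //; exact: causal_ker.
Qed.

Lemma measurable_frac_conv gamma u : measurable_fun setT u ->
  measurable_fun setT (frac_conv gamma u).
Proof.
move=> mu'; rewrite /frac_conv; case: ifP => // _.
by apply: measurable_conv => //; exact: measurable_rl_kernel.
Qed.

Lemma conv_frac_conv a gamma u t : 0 < a -> 0 <= gamma -> 1 <= a + gamma ->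
  rintegrable u -> causal u ->
  rintegrable (fun s => ker a (t - s) * frac_conv gamma u s) /\
  conv (ker a) (frac_conv gamma u) t = conv (ker (a + gamma)) u t.
Proof.
move=> a0 g0 ag1 su cu; rewrite /frac_conv; case: eqVneq => [gE|gn0].
  rewrite gE addr0 in ag1 *; split => //; exact: conv_rintegrable.
by apply: conv_semigroup => //; rewrite lt_neqAle eq_sym gn0.
Qed.

(** The indicator of [s < T] is written as a kernel of order 1: then
    [before T (conv k u)] is an integrand of the semigroup law, which proves that it
    is integrable. *)
Definition before T u (s : R) : R := ker 1 (T - s) * u s.

Lemma beforeE T u s : s < T -> before T u s = u s.
Proof. by move=> sT; rewrite /before rl_kernel1 ?mul1r// subr_gt0. Qed.

Lemma before_ge T u s : T <= s -> before T u s = 0.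
Proof. by move=> sT; rewrite /before rl_kernel_npos ?mul0r// subr_le0. Qed.

Lemma causal_before T u : causal u -> causal (before T u).
Proof. by move=> cu s s0; rewrite /before cu// mulr0. Qed.

Lemma eq_conv_before k u v t : causal k -> causal u -> causal v ->
  (forall s, 0 < s < t -> u s = v s) -> conv k u t = conv k v t.
Proof.
move=> ck cu cv uv; apply: eq_Rintegral => s _.
have [s0|s0] := leP s 0; first by rewrite cu// cv.
have [st|ts] := ltP s t; first by rewrite uv// s0.
by rewrite ck ?mul0r// subr_le0.
Qed.

Lemma ker2E t : 0 < t -> ker 2 t = t.
Proof.
move=> t0; have <- : conv (ker 1) (ker 1) t = ker 2 t.
  by rewrite conv_kernels//; congr (ker _ t); lra.
rewrite conv_kernel1; last exact: causal_ker.
have -> : \int[mu]_(s in `]0, t[) ker 1 s = \int[mu]_(s in `]0, t[) 1.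
  apply: eq_Rintegral => s; rewrite inE /= in_itv /= => /andP[s0 _].
  by rewrite rl_kernel1.
rewrite Rintegral_cst//= ?lebesgue_measure_itv /= ?lte_fin ?t0 ?sube0 ?mul1r//.
Qed.

Lemma continuous_ker a t : 0 < t -> {for t, continuous (ker a)}.
Proof.
move=> t0; rewrite /prop_for /continuous_at rl_kernelE//.
have H : x `^ (a - 1) / Gamma a @[x --> t] --> t `^ (a - 1) / Gamma a.
  have D : {for t, continuous (fun x : R => x `^ (a - 1))}.
    apply: differentiable_continuous; apply/derivable1_diffP.
    by have [] := is_derive1_powR (a - 1) t0.
  by apply: cvgM; [exact: D|exact: cvg_cst].
apply: cvg_trans H; apply: near_eq_cvg; near=> x; rewrite rl_kernelE//.
by near: x; exact: lt_nbhsr.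
Unshelve. all: by end_near. Qed.

(** A kernel of order [a > 1] is a primitive of a kernel of positive order, which
    makes the convolution an indefinite integral. *)
Lemma continuous_conv_ker a u t : 1 < a -> rintegrable u -> causal u -> 0 < t ->
  {for t, continuous (conv (ker a) u)}.
Proof.
move=> a1 su cu t0.
have a10 : 0 < a - 1 by lra.
have a11 : 1 <= 1 + (a - 1) by lra.
pose v := before (t + 1) (conv (ker (a - 1)) u).
have cc : causal (conv (ker (a - 1)) u).
  by apply: conv_causal => //; exact: causal_ker.
have sv : rintegrable v.
  by have [] := conv_semigroup (t + 1) ltr01 a10 a11 su cu.
have cv : causal v by exact: causal_before.
have E s : s <= t + 1 -> conv (ker a) u s = \int[mu]_(x in `[0, s]) v x.
  move=> st; rewrite -conv_kernel1_cc//.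
  have [_] := conv_semigroup s ltr01 a10 a11 su cu.
  rewrite (_ : 1 + (a - 1) = a); last by lra.
  move=> <-; apply: eq_conv_before => //; first exact: causal_ker.
  by move=> r /andP[_ rs]; rewrite /v beforeE//; lra.
have t10 : 0 < t + 1 by lra.
have := parameterized_integral_continuous (ltW t10) (rintegrable_itv `[0, t + 1] sv).
move=> /(continuous_within_itvP _ t10)[+ _ _].
move=> /(_ t); rewrite in_itv /= t0 ltrDl ltr01 => /(_ isT).
rewrite /prop_for /continuous_at /parameterized_integral -E ?lerDl//.
apply: cvg_trans; apply: near_eq_cvg; near=> s; rewrite E//.
by apply/ltW; near: s; apply: lt_nbhsl; rewrite ltrDl.
Unshelve. all: by end_near. Qed.

Lemma rintegrable_conv_before T a u : 0 < a -> rintegrable u -> causal u ->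
  rintegrable (before T (conv (ker a) u)).
Proof. by move=> a0 su cu; have [] := @conv_semigroup R 1 a u T ltr01 a0 ltac:(lra) su cu. Qed.

Lemma rintegrable_ker_before T a : 0 < a -> rintegrable (before T (ker a)).
Proof. exact: conv_kernels_rintegrable ltr01. Qed.

Lemma before_lin T a0 a1 u v w :
  before T (fun s => a0 * u s + a1 * v s + w s) =
  (fun s => a0 * before T u s + a1 * before T v s + before T w s).
Proof. by apply/funext => s; rewrite /before; ring. Qed.

Lemma conv_lin k a0 a1 u v w t : rintegrable (fun s => k (t - s) * u s) ->
  rintegrable (fun s => k (t - s) * v s) -> rintegrable (fun s => k (t - s) * w s) ->
  conv k (fun s => a0 * u s + a1 * v s + w s) t =
  a0 * conv k u t + a1 * conv k v t + conv k w t.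
Proof.
move=> su sv sw; have su' := rintegrableZ a0 su; have sv' := rintegrableZ a1 sv.
rewrite /conv -(RintegralZl _ measurableT su) -(RintegralZl _ measurableT sv).
rewrite -(RintegralD measurableT su' sv').
rewrite -(RintegralD measurableT (rintegrableD su' sv') sw).
by apply: eq_Rintegral => s _; ring.
Qed.

Lemma conv_ae k u v t : measurable_fun setT k -> measurable_fun setT u ->
  measurable_fun setT v -> {ae mu, forall s, k (t - s) * u s = k (t - s) * v s} ->
  conv k u t = conv k v t.
Proof. by move=> mk mu' mv; apply: Rintegral_ae; exact: measurable_conv_integrand. Qed.

#[local] Opaque conv.

(** The orders [d1], [d2], [d3] are variables tied by equations, rather than sums, so
    that equal orders that are written differently can be identified. *)
Lemma conv_ker_lin c b1 b2 b3 d1 d2 d3 a0 a1 u t :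
  0 < c -> 0 < b1 -> 0 < b2 -> 0 < b3 -> 1 <= d3 ->
  c + b1 = d1 -> c + b2 = d2 -> c + b3 = d3 -> rintegrable u -> causal u ->
  conv (ker c) (fun s => a0 * ker b1 s + a1 * ker b2 s + conv (ker b3) u s) t =
  a0 * ker d1 t + a1 * ker d2 t + conv (ker d3) u t.
Proof.
move=> c0 b10 b20 b30 d31 e1 e2 e3 su cu; subst d1 d2 d3.
have [s3 <-] := conv_semigroup t c0 b30 d31 su cu.
rewrite -(conv_kernels t c0 b10) -(conv_kernels t c0 b20).
by apply: conv_lin => //; exact: conv_kernels_rintegrable.
Qed.

Lemma conv_frac_convE a gamma c u t : 0 < a -> 0 <= gamma -> 1 <= c -> a + gamma = c ->
  rintegrable u -> causal u -> conv (ker a) (frac_conv gamma u) t = conv (ker c) u t.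
Proof. by move=> a0 g0 c1 e su cu; subst c; have [] := conv_frac_conv t a0 g0 c1 su cu. Qed.

(** A continuous function is the derivative of its indefinite integral. *)
Lemma conv1_inj T u v : rintegrable (before T u) -> rintegrable (before T v) ->
  causal u -> causal v ->
  (forall t, 0 < t < T -> {for t, continuous u}) ->
  (forall t, 0 < t < T -> {for t, continuous v}) ->
  (forall t, 0 < t < T -> conv (ker 1) u t = conv (ker 1) v t) ->
  forall t, 0 < t < T -> u t = v t.
Proof.
move=> su sv cu cv ctu ctv E t /andP[t0 tT].
pose w s := before T u s - before T v s.
have sw : rintegrable w by exact: (integrableB measurableT su sv).
have cw : causal w by move=> s s0; rewrite /w !causal_before// subrr.
have wE s : 0 < s < T -> \int[mu]_(x in `[0, s]) w x = 0.
  move=> sT; rewrite RintegralB//; [|exact: rintegrable_itv|exact: rintegrable_itv].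
  rewrite -!conv_kernel1_cc//; [|exact: causal_before|exact: causal_before].
  have bef f : causal f -> conv (ker 1) (before T f) s = conv (ker 1) f s.
    move=> cf; apply: eq_conv_before => //; [exact: causal_ker|exact: causal_before|].
    by move=> x /andP[_ xs]; rewrite beforeE//; lra.
  by rewrite !bef// E// subrr.
(* truncation does not change [u] and [v] near a point [t < T] *)
have ctw : {for t, continuous w}.
  have near_bef f : before T f x @[x --> t] --> f t -> {for t, continuous (before T f)}.
    by rewrite /prop_for /continuous_at beforeE.
  have H f : {for t, continuous f} -> {for t, continuous (before T f)}.
    move=> cf; apply: near_bef; apply: cvg_trans cf; apply: near_eq_cvg; near=> x.
    by rewrite beforeE//; near: x; exact: lt_nbhsl.
  by apply: cvgB; apply: H; [apply: ctu|apply: ctv]; rewrite t0.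
have [dF FE] := continuous_FTC1_closed tT (rintegrable_itv _ sw) t0 ctw.
suff : w t = 0 by rewrite /w !beforeE// => /eqP; rewrite subr_eq0 => /eqP.
rewrite -FE derive1E (near_eq_derive (g := cst 0)) ?derive_cst//.
near=> x; apply: wE; apply/andP; split.
  by near: x; exact: lt_nbhsr.
by near: x; exact: lt_nbhsl.
Unshelve. all: by end_near. Qed.

Lemma continuous_within_oc T f : 0 < T -> {within `]0, T], continuous f} ->
  (forall t, 0 < t < T -> {for t, continuous f}) /\ f s @[s --> T^'-] --> f T.
Proof.
move=> T0 cf.
have H t : 0 < t -> t < T -> {for t, continuous f} /\ f s @[s --> T^'-] --> f T.
  move=> t0 tT; have t2T : t / 2 < T by lra.
  have : {within `[t / 2, T], continuous f}.
    by apply: continuous_subspaceW cf; apply: subset_itvr; rewrite bnd_simp; lra.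
  move=> /(continuous_within_itvP _ t2T)[c _ cT]; split => //.
  by apply: c; rewrite in_itv /=; lra.
split; first by move=> t /andP[t0 tT]; have [] := H t t0 tT.
by have [] := H (T / 2) ltac:(lra) ltac:(lra).
Qed.

(** Here [g = I^beta z = a0 + a1 t + I^2 q] and [I^alpha q = F].  Since
    [2 = (m + beta) + alpha], the semigroup law turns [I^2 q] into [I^(m + beta) F].
    Applying [I^(1 - beta)] to both expressions of [g] gives
    [I^1 z = I^1 (a0 k_b1 + a1 k_b2 + I^m F)], and integration from 0 is injective. *)
Lemma volterra_of_hilfer (alpha beta m b1 b2 T a0 a1 : R) (z g q F : R -> R) :
  0 <= alpha -> 0 <= beta -> 1 < m -> alpha + beta = 2 - m ->
  b1 = 1 - beta -> b2 = 2 - beta -> 0 < T ->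
  rintegrable z -> causal z -> {within `]0, T], continuous z} ->
  rintegrable q -> causal q -> rintegrable F -> causal F ->
  (forall t, 0 < t < T -> g t = frac_conv beta z t) ->
  (forall t, 0 < t < T -> g t = a0 + a1 * t + conv (ker 2) q t) ->
  {ae mu, forall t, 0 < t < T -> frac_conv alpha q t = F t} ->
  forall t, 0 < t <= T -> z t = a0 * ker b1 t + a1 * ker b2 t + conv (ker m) F t.
Proof.
move=> al0 be0 m1 abm b1E b2E T0 sz cz ctz sq cq sF cF gz gq eqF.
(* the orders are variables, so that kernels of equal order match syntactically *)
have [b3 b3E] : exists b3, b3 = 3 - beta by eexists.
have [c cE] : exists c, c = m + beta by eexists.
have [m' mE] : exists m', m' = m + 1 by eexists.
have [one oneE] : exists one : R, one = 1 by eexists.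
have [two twoE] : exists two : R, two = 2 by eexists.
rewrite -twoE in gq.
have one0 : 0 < one by lra.
have two0 : 0 < two by lra.
have b10 : 0 < b1 by lra.
have b20 : 0 < b2 by lra.
have c0 : 0 < c by lra.
have m0 : 0 < m by lra.
have m'1 : 1 <= m' by lra.
pose W t := a0 * ker b1 t + a1 * ker b2 t + conv (ker m) F t.
have cker a : causal (ker a : R -> R) by exact: causal_ker.
have ccF a : causal (conv (ker a) F) by exact: conv_causal.
have cW : causal W by move=> t t0; rewrite /W !cker// ccF// !mulr0 !addr0.
have mker a : measurable_fun setT (ker a : R -> R) by exact: measurable_rl_kernel.
have q2 t : 0 < t < T -> conv (ker two) q t = conv (ker c) F t.
  move=> /andP[t0 tT].
  rewrite -(@conv_frac_convE c alpha two q t c0 al0 ltac:(lra) ltac:(lra) sq cq).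
  apply: conv_ae; [exact: mker|exact: measurable_frac_conv (rintegrable_measurable sq)|
    exact: rintegrable_measurable sF|].
  move: eqF; apply: filterS; first exact: (ae_filter_ringOfSetsType mu).
  move=> s hs; have [s0|s0] := leP s 0.
    by rewrite cF// causal_frac_conv.
  have [st|ts] := ltP s t; first by rewrite hs// s0 (lt_trans st tT).
  by rewrite rl_kernel_npos ?mul0r// subr_le0.
have ker1W t : conv (ker one) W t = a0 * ker b2 t + a1 * ker b3 t + conv (ker m') F t.
  by apply: conv_ker_lin => //; lra.
(* apply [I^(1 - beta)] to [g = a0 k_1 + a1 k_2 + I^(m + beta) F] *)
have ker1z t : 0 < t < T -> conv (ker one) z t = conv (ker one) W t.
  move=> /andP[t0 tT]; rewrite ker1W.
  rewrite -(@conv_frac_convE b1 beta one z t b10 be0 ltac:(lra) ltac:(lra) sz cz).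
  transitivity (conv (ker b1)
      (fun s => a0 * ker one s + a1 * ker two s + conv (ker c) F s) t).
    apply: eq_conv_before; [exact: cker|exact: causal_frac_conv| |].
      by move=> s s0; rewrite !cker// ccF// !mulr0 !addr0.
    move=> s /andP[s0 st]; have sT : 0 < s < T by rewrite s0 (lt_trans st tT).
    by rewrite -gz// gq// q2// oneE twoE rl_kernel1// ker2E// mulr1.
  by apply: conv_ker_lin => //; lra.
rewrite oneE in ker1z.
have ctW t : 0 < t -> {for t, continuous W}.
  move=> t0; apply: cvgD; last exact: continuous_conv_ker.
  by apply: cvgD; apply: cvgM; try exact: cvg_cst; exact: continuous_ker.
have [zin zT] := continuous_within_oc T0 ctz.
have E : forall t, 0 < t < T -> z t = W t.
  apply: (@conv1_inj T) => //.
  - apply: (rintegrable_le _ _ sz); last first.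
      move=> s; have [sT|Ts] := ltP s T; first by rewrite beforeE.
      by rewrite before_ge// normr0.
    by apply: measurable_conv_integrand => //; exact: rintegrable_measurable.
  - rewrite /W before_lin; apply: rintegrableD; last exact: rintegrable_conv_before.
    by apply: rintegrableD; apply: rintegrableZ; exact: rintegrable_ker_before.
  - by move=> t /andP[t0 _]; exact: ctW.
move=> t /andP[t0]; rewrite le_eqVlt => /predU1P[->|tT]; last by apply: E; rewrite t0.
rewrite -/(W T).
have WT : W s @[s --> T^'-] --> W T by apply: cvg_at_left_filter; exact: ctW.
(* the end point [T] is reached by continuity from the left *)
have zT' : z s @[s --> T^'-] --> W T.
  apply: cvg_trans WT; apply: near_eq_cvg; near=> s; apply/esym/E/andP; split.
    by near: s; exact: nbhs_left_gt.
  by near: s; exact: nbhs_left_lt.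
exact: (cvg_unique _ zT zT').
Unshelve. all: by end_near. Qed.

End Inversion.

(** * The Volterra equation of the delayed problem *)

Section VectorVolterra.
Context {R : realType} {d : nat}.
Notation mu := (@lebesgue_measure R).
Notation ker := rl_kernel.
Implicit Types (a b t : R) (u v : R -> 'cV[R]_d).

Lemma Rintegral_cc_oo (f : R -> R) a b : measurable_fun `]a, b[ f ->
  \int[mu]_(s in `[a, b]) f s = \int[mu]_(s in `]a, b[) f s.
Proof.
move=> mf; rewrite /Rintegral.
rewrite -integral_itv_bndo_bndc; last first.
  by apply/measurable_EFinP/measurable_fun_itv_obnd_cbndP.
by rewrite -integral_itv_obnd_cbnd//; exact/measurable_EFinP.
Qed.

(** Holds for every measurable [f]: an integral that is infinite or undefined
    stays so after scaling by [c > 0], and its real value is then 0. *)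
Lemma Rintegral_pos_scale c (f : R -> R) : 0 < c -> measurable_fun setT f ->
  \int[mu]_s (c * f s) = c * \int[mu]_s f s.
Proof.
move=> c0 mf; rewrite /Rintegral; under eq_integral do rewrite EFinM.
rewrite [in LHS]integralE [in RHS]integralE.
have mF : measurable_fun setT (EFin \o f) by exact/measurable_EFinP.
rewrite (ge0_funeposM (EFin \o f) (ltW c0)) (ge0_funenegM (EFin \o f) (ltW c0)).
rewrite (ge0_integralZl mu measurableT (measurable_funepos mF)) ?lee_fin ?ltW//.
rewrite (ge0_integralZl mu measurableT (measurable_funeneg mF)) ?lee_fin ?ltW//.
have : (0 <= \int[mu]_x (EFin \o f)^\+ x)%E by apply: integral_ge0.
have : (0 <= \int[mu]_x (EFin \o f)^\- x)%E by apply: integral_ge0.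
move: (integral _ _ _) (integral _ _ _) => [p| |] [n| |] //= _ _;
  rewrite ?gt0_muley ?lte_fin//= ?mulr0 ?addNye ?addeNy//=.
by rewrite mulrBr.
Qed.

(** The kernel vanishes to the right of [t] and [v] to the left of 0, and end points
    are negligible, so the integral over [[0, t]] is one over the whole line. *)
Lemma frac_int_conv gamma u (v : R -> R) i t : 0 < gamma -> measurable_fun setT v ->
  causal v -> 0 < t -> (forall s, 0 < s < t -> u s i ord0 = v s) ->
  frac_int 0 gamma u t i ord0 = conv (ker gamma) v t.
Proof.
move=> g0 mv cv t0 uv; rewrite /frac_int gt_eqF// !mxE.
have G0 : Gamma gamma != 0 :> R by rewrite gt_eqF ?Gamma_gt0.
pose w s := Gamma gamma * (ker gamma (t - s) * v s).
have mw : measurable_fun setT w.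
  apply: measurable_funM => //.
  exact: measurable_conv_integrand (measurable_rl_kernel _) mv.
have E s : 0 < s < t -> ((t - s) `^ (gamma - 1) *: u s) i ord0 = w s.
  move=> /andP[s0 st]; rewrite mxE uv ?s0// /w rl_kernelE ?subr_gt0//.
  by rewrite mulrA; congr (_ * _); rewrite mulrCA mulfV// mulr1.
rewrite Rintegral_cc_oo; last first.
  apply: (eq_measurable_fun w); last exact: measurable_funTS.
  by move=> s; rewrite inE /= in_itv /= => /E ->.
rewrite Rintegral_mkcond /conv.
have -> : \int[mu]_s ((fun s => ((t - s) `^ (gamma - 1) *: u s) i ord0) \_ `]0, t[) s =
    \int[mu]_s w s.
  apply: eq_Rintegral => s _; rewrite patchE; case: ifPn => [|].
    by rewrite inE /= in_itv /= => /E.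
  rewrite notin_setE /= in_itv /= => /negP; rewrite negb_and -!leNgt /w => /orP[s0|ts].
    by rewrite cv// !mulr0.
  by rewrite rl_kernel_npos ?mul0r ?mulr0// subr_le0.
rewrite Rintegral_pos_scale ?Gamma_gt0 ?mulrA ?mulVf ?mul1r//.
exact: measurable_conv_integrand (measurable_rl_kernel _) mv.
Qed.

Definition vrintegrable u : Prop := forall i, rintegrable (fun s => u s i ord0).
Definition vcausal u : Prop := forall s, s <= 0 -> u s = 0.

Lemma rintegrable_restrict (f : R -> R) (D : set R) : measurable D ->
  mu.-integrable D (EFin \o f) -> rintegrable (f \_ D).
Proof. by move=> mD; rewrite integrable_mkcond// restrict_EFin. Qed.

Lemma vrintegrableD u v : vrintegrable u -> vrintegrable v ->
  vrintegrable (fun s => u s + v s).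
Proof.
move=> su sv i; rewrite (_ : (fun s => _) = fun s => u s i ord0 + v s i ord0).
  exact: rintegrableD.
by apply/funext => s; rewrite mxE.
Qed.

Lemma vrintegrable_mul (M : 'M[R]_d) u : vrintegrable u ->
  vrintegrable (fun s => M *m u s).
Proof.
move=> su i; rewrite (_ : (fun s => _) = fun s => \sum_j M i j * u s j ord0).
  by apply: rintegrable_sum => j; exact: rintegrableZ.
by apply/funext => s; rewrite mxE.
Qed.

Lemma vrintegrableN u : vrintegrable u -> vrintegrable (fun s => - u s).
Proof.
move=> su i; rewrite (_ : (fun s => _) = fun s => -1 * u s i ord0).
  exact: rintegrableZ.
by apply/funext => s; rewrite mxE mulN1r.
Qed.

Lemma vrintegrableB u v : vrintegrable u -> vrintegrable v ->
  vrintegrable (fun s => u s - v s).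
Proof. by move=> su sv; apply: vrintegrableD => //; exact: vrintegrableN. Qed.

Lemma vrintegrable_shift h u : vrintegrable u -> vrintegrable (fun s => u (s - h)).
Proof. by move=> su i; exact: (rintegrable_shift h (su i)). Qed.

Definition cutoff a b u (s : R) : 'cV[R]_d := if a < s <= b then u s else 0.

Lemma vrintegrable_cutoff a b u : vintegrable `]a, b] u -> vrintegrable (cutoff a b u).
Proof.
move=> iu i; rewrite (_ : (fun s => _) = (fun s => u s i ord0) \_ `]a, b]).
  exact: (rintegrable_restrict (measurable_itv _) (iu i)).
apply/funext => s; rewrite /cutoff patchE; case: ifPn => sab.
  by rewrite mem_set//= in_itv.
by rewrite memNset ?mxE//= in_itv /=; apply/negP.
Qed.

Lemma vintegrable_continuous a b u : {within `[a, b], continuous u} ->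
  vintegrable `]a, b] u.
Proof.
move=> cu i.
have iu : mu.-integrable `[a, b] (EFin \o (fun s => u s i ord0)).
  apply: continuous_compact_integrable; first exact: segment_compact.
  move=> s; apply: (@continuous_comp _ _ _ _ (fun M : 'cV[R]_d => M i ord0)).
    exact: cu.
  exact: coord_continuous.
by apply: integrableS iu => //; apply: subset_itvr; rewrite bnd_simp.
Qed.

(** The increment is [s - t] times a difference quotient that converges. *)
Lemma C1_segment_continuous a b u : C1_segment a b u -> {within `[a, b], continuous u}.
Proof.
move=> [df _ D]; apply/subspace_continuousP => t /= tab.
have H := D t tab.
pose F := within `[a, b]%classic t^'.
have idF : s @[s --> F] --> t.
  by apply: cvg_trans (@nbhs_dnbhs _ t); exact: cvg_within.
have L : (s - t) *: ((s - t)^-1 *: (u s - u t)) @[s --> F] --> (t - t) *: df t.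
  by apply: cvgZ => //; apply: cvgB => //; exact: cvg_cst.
rewrite subrr scale0r in L.
apply/cvgrPdist_le => e e0.
have N : \forall s \near t, s != t -> `[a, b]%classic s ->
    `|0 - (s - t) *: ((s - t)^-1 *: (u s - u t))| <= e.
  by move/cvgrPdist_le : L => /(_ e e0).
suff : \forall s \near t, `[a, b]%classic s -> `|u t - u s| <= e by [].
apply: filterS N => s Hs sab; have [->|st] := eqVneq s t.
  by rewrite subrr normr0 ltW.
by have := Hs st sab; rewrite scalerA mulfV ?scale1r ?subr_eq0// sub0r opprB.
Qed.

Lemma vcausal_cutoff b u : vcausal (cutoff 0 b u).
Proof. by move=> s s0; rewrite /cutoff ltNge s0. Qed.

Section Hilfer.
Variables (m nu h T b1 b2 : R) (A Om : 'M[R]_d) (f phi z : R -> 'cV[R]_d).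
Variables (a0 a1 : 'cV[R]_d).
Hypotheses (hm : 1 < m < 2) (hnu : 0 <= nu <= 1) (hh : 0 < h) (hT : 0 < T).
Hypotheses (hb1 : b1 = 1 - (1 - nu) * (2 - m)) (hb2 : b2 = 2 - (1 - nu) * (2 - m)).
Hypothesis hf : {within `[0, T], continuous f}.
Hypothesis hphi : C1_segment (- h) 0 phi.
Hypothesis hz : hilfer_regular m nu T z.
Hypothesis hz_eq : {ae mu, forall t : R, t \in `]0, T[ ->
     hilfer 2 0 m nu z t + A *m z t + Om *m z (t - h) = f t}.
Hypothesis hz_phi : forall t : R, t \in `[- h, 0] -> z t = phi t.
Hypothesis hz_a0 : frac_int 0 ((1 - nu) * (2 - m)) z t @[t --> 0^'+] --> a0.
Hypothesis hz_a1 : frac_int_pred 0 ((1 - nu) * (2 - m)) z t @[t --> 0^'+] --> a1.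

Let beta := (1 - nu) * (2 - m).
Let g := frac_int 0 beta z.

Definition solution_part : R -> 'cV[R]_d := cutoff 0 T z.
(** Splitting [z (s - h)] into the solution on [ ]0, T] ] and the history on
    [ ]-h, 0] ] makes the history a known term of the equation. *)
Definition source_part (s : R) : 'cV[R]_d :=
  cutoff 0 T f s - Om *m cutoff (- h) 0 phi (s - h).

Lemma vcausal_source_part : vcausal source_part.
Proof.
move=> s s0; rewrite /source_part vcausal_cutoff// /cutoff.
by rewrite (_ : - h < s - h = false) ?mulmx0 ?subr0//; apply/negbTE; rewrite -leNgt; lra.
Qed.

Lemma vrintegrable_solution_part : vrintegrable solution_part.
Proof. by apply: vrintegrable_cutoff; case: hz. Qed.

Lemma vrintegrable_source_part : vrintegrable source_part.
Proof.
apply: vrintegrableB; first exact/vrintegrable_cutoff/vintegrable_continuous.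
apply: vrintegrable_mul; apply: (vrintegrable_shift h).
exact/vrintegrable_cutoff/vintegrable_continuous/C1_segment_continuous.
Qed.

Lemma delayed_solution s : 0 < s < T ->
  z (s - h) = solution_part (s - h) + cutoff (- h) 0 phi (s - h).
Proof.
move=> /andP[s0 sT]; rewrite /solution_part /cutoff; have [sh|sh] := leP (s - h) 0.
  rewrite hz_phi ?in_itv /=; last by rewrite sh; lra.
  by rewrite /= add0r andbT ifT//; lra.
have sT' : s - h <= T by move: hh sT; lra.
by rewrite andbF addr0 sT'.
Qed.

(** The regularity of the solution supplies the hypotheses of [taylor2] and
    [volterra_of_hilfer] for each component, with [q] the second derivative of
    [frac_int 0 beta z]. *)
Lemma hilfer_volterra t i : 0 < t <= T ->
  z t i ord0 = a0 i ord0 * ker b1 t + a1 i ord0 * ker b2 t +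
    conv (ker m) (fun s => (source_part s -
      (A *m solution_part s + Om *m solution_part (s - h))) i ord0) t.
Proof.
move=> tT; have [ctz iz dg acp ig] := hz.
have [/andP[m1 m2] /andP[nu0 nu1]] := conj hm hnu.
have h0 : 0 < h := hh; have T0 : 0 < T := hT.
move: dg acp ig; rewrite -/beta -/g => dg acp ig.
have [alpha alE] : exists alpha, alpha = nu * (2 - m) by eexists.
have be0 : 0 <= beta by rewrite /beta mulr_ge0 ?subr_ge0// ltW.
have al0 : 0 <= alpha by rewrite alE mulr_ge0 ?subr_ge0// ltW.
(* the second derivative is integrable on the open interval only *)
pose q s := (cutoff 0 T (fun s => if s < T then derive1n 2 g s else 0) s) i ord0.
have qE s : 0 < s < T -> q s = derive1n 2 g s i ord0.
  by move=> /andP[s0 sT]; rewrite /q /cutoff s0 ltW//= sT.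
have iq : rintegrable q.
  rewrite (_ : q = (fun s => derive1n 2 g s i ord0) \_ `]0, T[).
    exact: (rintegrable_restrict (measurable_itv _) (ig i)).
  apply/funext => s; rewrite patchE; case: ifPn => [|].
    by rewrite inE /= in_itv /= => /qE.
  rewrite notin_setE /= in_itv /= => /negP; rewrite /q /cutoff.
  case: (0 < s) => //=; last by rewrite mxE.
  by move=> /negbTE ->; case: ifP => _; rewrite mxE.
have cq : causal q by move=> s s0; rewrite /q vcausal_cutoff// mxE.
pose zi s := solution_part s i ord0.
have szi : rintegrable zi by exact: vrintegrable_solution_part.
have czi : causal zi by move=> s s0; rewrite /zi /solution_part vcausal_cutoff// mxE.
pose F s := (source_part s - (A *m solution_part s + Om *m solution_part (s - h))) i ord0.
have sF : rintegrable F.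
  have vF : vrintegrable (fun s => source_part s -
      (A *m solution_part s + Om *m solution_part (s - h))).
    apply: vrintegrableB; first exact: vrintegrable_source_part.
    apply: vrintegrableD; apply: vrintegrable_mul; last apply: vrintegrable_shift;
      exact: vrintegrable_solution_part.
  exact: vF.
have cF : causal F.
  move=> s s0; rewrite /F vcausal_source_part// /solution_part !vcausal_cutoff//; last by lra.
  by rewrite !mulmx0 addr0 subr0 mxE.
have gz s : 0 < s < T -> g s i ord0 = frac_conv beta zi s.
  move=> /andP[s0 sT].
  have zE r : 0 < r < T -> z r i ord0 = zi r.
    by move=> /andP[r0 rT]; rewrite /zi /solution_part /cutoff r0 ltW.
  rewrite /frac_conv; case: eqVneq => [bE|bn0].
    by rewrite /g /frac_int bE eqxx zE ?s0.
  apply: frac_int_conv => //; first by rewrite lt_neqAle eq_sym bn0.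
    exact: rintegrable_measurable.
  by move=> r /andP[r0 rs]; apply: zE; rewrite r0 (lt_trans rs).
have dgi s : 0 < s < T -> is_derive s 1 (fun s => g s i ord0) (derive1 g s i ord0).
  move=> sT; have ds := dg s ltac:(by rewrite in_itv).
  have di := (derivable_mxP g s 1).1 ds i ord0.
  by apply: DeriveDef => //; rewrite derive1E (derive_mx ds) mxE.
have taylor : forall s, 0 < s < T ->
    g s i ord0 = a0 i ord0 + a1 i ord0 * s + conv (ker 2) q s.
  apply: (@taylor2 R (fun s => g s i ord0) (fun s => derive1 g s i ord0) q T
    (a0 i ord0) (a1 i ord0) dgi _ iq cq).
  - move=> b c b0 bc cT; apply: (@abs_continuous_AC _ _ b c (derive1 g)) => //.
    exact: acp.
  - move=> b c b0 bc cT.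
    have D (j : 'I_d) : {ae mu, forall x, b < x < c ->
        derivable (fun s => derive1 g s j ord0) x 1}.
      have [rho [_ _ D]] := @AC_FTC R (fun s => derive1 g s j ord0) b c bc
        (abs_continuous_AC j bc (acp b c b0 bc cT)).
      move: D; apply: filterS; first exact: (ae_filter_ringOfSetsType mu).
      by move=> x Hx bxc; have [] := Hx bxc.
    have {}D : {ae mu, forall x, forall j : 'I_d, b < x < c ->
        derivable (fun s => derive1 g s j ord0) x 1}.
      by apply: (@filter_forall _ _ _ _ (ae_filter_ringOfSetsType mu)) => j; exact: D.
    apply: (@filterS _ _ (ae_filter_ringOfSetsType mu) _ _ _ D).
    move=> x Hx bxc; rewrite qE; last by move: bxc => /andP[? ?]; apply/andP; split; lra.
    have dx : derivable (derive1 g) x 1.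
      by apply/derivable_mxP => j k; rewrite (ord1 k); exact: Hx.
    by rewrite derive1nS derive1n1 !derive1E (derive_mx dx) mxE.
  - exact: (cvg_comp _ (fun M : 'cV[R]_d => M i ord0) hz_a0 (@coord_continuous _ _ _ i ord0 a0)).
  - exact: (cvg_comp _ (fun M : 'cV[R]_d => M i ord0) hz_a1 (@coord_continuous _ _ _ i ord0 a1)).
have eqF : {ae mu, forall s, 0 < s < T -> frac_conv alpha q s = F s}.
  move: hz_eq; apply: filterS; first exact: (ae_filter_ringOfSetsType mu).
  move=> s + sT => /(_ ltac:(by rewrite in_itv)) E.
  have [s0 sT'] := andP sT.
  have -> : frac_conv alpha q s = hilfer 2 0 m nu z s i ord0.
    rewrite /hilfer -alE -/beta -/g /frac_conv; case: eqVneq => [aE|an0].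
      by rewrite /frac_int aE eqxx qE.
    apply/esym/frac_int_conv => //; first by rewrite lt_neqAle eq_sym an0.
      exact: rintegrable_measurable.
    by move=> r /andP[r0 rs]; rewrite qE// r0 (lt_trans rs).
  rewrite /F; congr (fun_of_matrix _ i ord0).
  rewrite /source_part {1}/cutoff s0 (ltW sT') /= -E delayed_solution//.
  have -> : solution_part s = z s by rewrite /solution_part /cutoff s0 ltW.
  rewrite mulmxDr.
  move: (hilfer _ _ _ _ _ _) (A *m z s) (Om *m _) (Om *m _) => x y v w.
  by rewrite [RHS]addrAC -addrA !opprD; apply/matrixP => k l; rewrite !mxE; ring.
have czT : {within `]0, T], continuous zi}.
  apply: (@subspace_eq_continuous _ _ _ (fun s => z s i ord0)).
    move=> s; rewrite inE /= in_itv /= => sT.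
    by rewrite /from_subspace /zi /solution_part /cutoff ifT.
  move=> s; apply: (@continuous_comp _ _ _ _ (fun M : 'cV[R]_d => M i ord0)).
    exact: ctz.
  exact: coord_continuous.
have := @volterra_of_hilfer R alpha beta m b1 b2 T (a0 i ord0) (a1 i ord0) zi
  (fun s => g s i ord0) q F al0 be0 ltac:(lra) ltac:(rewrite alE /beta; ring) hb1 hb2 hT
  szi czi czT iq cq sF cF gz taylor eqF t tT.
by rewrite /zi /solution_part /cutoff tT.
Qed.

End Hilfer.
End VectorVolterra.

(** * The coefficients of the delayed Mittag-Leffler function *)

Section DelayedCoefficients.
Context {R : realType} {d : nat}.
Variables (A Om : 'M[R]_d).
Notation Q := (Qmx A Om).
Notation ker := rl_kernel.

Lemma Qmx_lt k j : (k < j)%N -> Q k j = 0.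
Proof. by case: j => // j kj; rewrite /= big_geq. Qed.

Lemma Qmx0r k : Q k 0 = A ^+ k. Proof. by []. Qed.

Lemma Qmx0l j : Q 0 j = if j is 0%N then 1%:M else 0.
Proof. by case: j => [|j]; [rewrite Qmx0r expr0|rewrite Qmx_lt]. Qed.

Lemma QmxS k j : Q k.+1 j = A *m Q k j + (if j is j'.+1 then Om *m Q k j' else 0).
Proof.
case: j => [|j]; first by rewrite !Qmx0r exprS addr0.
have [kj|jk] := ltnP k j.
  by rewrite !Qmx_lt ?mulmx0 ?addr0// ltnS ltnW.
rewrite /= big_nat_recr//= subnn expr0 mul1mx; congr (_ + _).
rewrite mulmx_sumr; apply: eq_big_nat => l /andP[_ lk].
by rewrite subSn// exprS !mulmxA.
Qed.

(** [Q k j] is the sum of all words with [k] letters, [j] of them [Om] and the others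
    [A].  The defining recursion peels off the first letter, this one the last. *)
Lemma QmxSr k j : Q k.+1 j = Q k j *m A + (if j is j'.+1 then Q k j' *m Om else 0).
Proof.
elim: k j => [|k IH] j.
  rewrite QmxS; case: j => [|[|j]]; rewrite !Qmx0l ?mulmx1 ?mul1mx//.
  - by rewrite mulmx0 mul0mx.
  - by rewrite !mulmx0 !mul0mx.
rewrite QmxS [in LHS]IH; case: j => [|j].
  by rewrite !addr0 mulmxA QmxS addr0.
rewrite [in LHS]IH [Q k.+1 j.+1 in RHS]QmxS [Q k.+1 j in RHS]QmxS.
rewrite !mulmxDr !mulmxDl !mulmxA.
case: j => [|j]; first by rewrite !mulmx0 mul0mx !addr0 addrAC.
by rewrite !mulmxA addrACA.
Qed.

Lemma mx_norm_le (m n : nat) (M : 'M[R]_(m, n)) c : 0 <= c ->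
  (forall i j, `|M i j| <= c) -> `|M| <= c.
Proof. by move=> c0 H; rewrite [leLHS]mx_normrE; apply: bigmax_le => // -[i j] _; exact: H. Qed.

Lemma norm_mulmx (M N : 'M[R]_d) : `|M *m N| <= d%:R * `|M| * `|N|.
Proof.
apply: mx_norm_le => [|i j]; first by rewrite !mulr_ge0.
rewrite mxE; apply: le_trans (ler_norm_sum _ _ _) _.
have -> : d%:R * `|M| * `|N| = \sum_(l < d) `|M| * `|N|.
  by rewrite sumr_const card_ord -mulrA mulr_natl.
by apply: ler_sum => l _; rewrite normrM ler_pM// normr_coord.
Qed.

(** The norm of a matrix is the largest absolute value of its entries; the factor
    [d%:R] makes it bound products. *)
Definition letter_norm : R := d%:R * (`|A| + `|Om|).

Lemma letter_norm_ge0 : 0 <= letter_norm.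
Proof. by rewrite mulr_ge0// addr_ge0. Qed.

Lemma Qmx_norm k j : `|Q k j| <= letter_norm ^+ k.
Proof.
elim: k j => [|k IH] j.
  rewrite Qmx0l; apply: mx_norm_le => [|i l]; first by rewrite expr0.
  by case: j => [|j]; rewrite !mxE ?normr0//; case: eqP; rewrite ?normr1 ?normr0.
have P0 := exprn_ge0 k letter_norm_ge0.
have B (M : 'M[R]_d) l : `|M *m Q k l| <= d%:R * `|M| * letter_norm ^+ k.
  by apply: le_trans (norm_mulmx _ _) _; rewrite ler_wpM2l// mulr_ge0.
rewrite QmxS exprS {1}/letter_norm mulrDr mulrDl.
apply: le_trans (ler_normD _ _) _; apply: lerD => //.
by case: j => [|j] //; rewrite normr0 !mulr_ge0.
Qed.

End DelayedCoefficients.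

(** * Decay of the kernels of high order *)

Section KernelGrowth.
Context {R : realType}.
Notation ker := rl_kernel.

(** By [Gamma_growth] with [L = T * lam], the kernel of order [x] is at most a
    multiple of [lam ^ (- x)] up to time [T], for every [lam]. *)
Lemma ker_geometric (T q : R) : 0 < T -> 0 <= q -> exists2 C : R, 0 <= C &
  forall (k : nat) x tau, k%:R <= x -> 1 <= x -> tau <= T ->
  ker x tau * q ^+ k <= C * 2^-1 ^+ k.
Proof.
(* [q / lam < 1 / 2], and [1 <= lam] makes [lam ^ (- x)] decrease with [x] *)
move=> T0 q0; have [lam lamE] : exists lam, lam = 2 * (q + 1) by eexists.
pose L := T * lam.
have lam1 : 1 <= lam by lra.
have L0 : 0 < L by rewrite mulr_gt0//; lra.
exists (expR (L + 1) * lam); first by rewrite mulr_ge0 ?expR_ge0//; lra.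
move=> k x tau kx x1 tT.
have x0 : 0 < x by lra.
have lam0 : 0 < lam by lra.
have H : ker x tau <= expR (L + 1) * (lam * lam^-1 ^+ k).
  apply: le_trans (rl_kernel_nd x1 tT) _; rewrite rl_kernelE//.
  rewrite ler_pdivrMr ?Gamma_gt0//.
  have G := Gamma_growth x1 L0.
  have e0 := expR_gt0 (L + 1).
  have c0 : 0 <= expR (L + 1) * (lam * lam^-1 ^+ k).
    by rewrite !mulr_ge0 ?exprn_ge0 ?invr_ge0 ?expR_ge0//; lra.
  apply: le_trans (ler_wpM2l c0 G).
  rewrite expRN [X in _ <= X](_ : _ = lam * lam^-1 ^+ k * L `^ (x - 1)); last first.
    by field; rewrite gt_eqF.
  rewrite /L powRM; [|lra|lra].
  have K : 1 <= lam * lam^-1 ^+ k * lam `^ (x - 1).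
    rewrite exprVn mulrAC ler_pdivlMr ?exprn_gt0// mul1r.
    rewrite -powR_mulrn ?(ltW lam0)// -{2}[lam](powRr1 (ltW lam0)) -powRD; last first.
      by rewrite (gt_eqF lam0) implybT.
    by apply: ler_powR => //; lra.
  rewrite mulrCA; apply: ler_peMr => //; exact: powR_ge0.
apply: le_trans (ler_wpM2r (exprn_ge0 k q0) H) _.
rewrite -!mulrA ler_pM2l ?expR_gt0// (ler_pM2l lam0) -exprMn.
apply: lerXn2r; rewrite ?nnegrE ?mulr_ge0 ?invr_ge0 ?(ltW lam0)//.
by rewrite ler_pdivrMl//; lra.
Qed.

End KernelGrowth.

(** * Iteration of the Volterra equation *)

Section Neumann.
Context {R : realType} {d : nat}.
Notation mu := (@lebesgue_measure R).
Notation ker := rl_kernel.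
Implicit Types (c t : R) (u v : R -> 'cV[R]_d).

Definition vconv c u t : 'cV[R]_d := \col_i conv (ker c) (fun s => u s i ord0) t.

Lemma causal_coord u i : vcausal u -> causal (fun s => u s i ord0).
Proof. by move=> cu s s0; rewrite cu// mxE. Qed.

Lemma vconv_causal c u : vcausal u -> vcausal (vconv c u).
Proof.
move=> cu s s0; apply/colP => i; rewrite !mxE.
by apply: conv_causal => //; [exact: causal_ker|exact: causal_coord].
Qed.

Lemma vconvD c u v t : 1 <= c -> vrintegrable u -> vcausal u -> vrintegrable v ->
  vcausal v -> vconv c (fun s => u s + v s) t = vconv c u t + vconv c v t.
Proof.
move=> c1 su cu sv cv; apply/colP => i; rewrite !mxE /conv.
have su' := conv_rintegrable t c1 (su i) (causal_coord i cu).
have sv' := conv_rintegrable t c1 (sv i) (causal_coord i cv).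
rewrite -(RintegralD measurableT su' sv').
by apply: eq_Rintegral => s _; rewrite mxE mulrDr.
Qed.

Lemma vconv_mul c (M : 'M[R]_d) u t : 1 <= c -> vrintegrable u -> vcausal u ->
  vconv c (fun s => M *m u s) t = M *m vconv c u t.
Proof.
move=> c1 su cu; apply/colP => i; rewrite !mxE /conv.
have su' j := conv_rintegrable t c1 (su j) (causal_coord j cu).
have sM j := rintegrableZ (M i j) (su' j).
under [RHS]eq_bigr => j _ do rewrite mxE /conv -(RintegralZl _ measurableT (su' j)).
rewrite -(Rintegral_sum sM); apply: eq_Rintegral => s _.
by rewrite mxE mulr_sumr; apply: eq_bigr => j _; rewrite mulrCA.
Qed.

Lemma vconvN c u t : 1 <= c -> vrintegrable u -> vcausal u ->
  vconv c (fun s => - u s) t = - vconv c u t.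
Proof.
move=> c1 su cu; rewrite -[RHS]mul1mx mulmxN -mulNmx -(vconv_mul _ _ c1 su cu).
by congr (vconv c _ t); apply/funext => s; rewrite mulNmx mul1mx.
Qed.

Lemma vconv_shift c h u t : vrintegrable u ->
  vconv c (fun s => u (s - h)) t = vconv c u (t - h).
Proof.
move=> su; apply/colP => i; rewrite !mxE.
rewrite (@conv_shift _ (ker c) (fun s => u s i ord0))//; first exact: measurable_rl_kernel.
exact: rintegrable_measurable (su i).
Qed.

Lemma vcausal_shift h u : 0 <= h -> vcausal u -> vcausal (fun s => u (s - h)).
Proof. by move=> h0 cu s s0; rewrite cu//; lra. Qed.

Lemma vcausal_mul (M : 'M[R]_d) u : vcausal u -> vcausal (fun s => M *m u s).
Proof. by move=> cu s s0; rewrite cu ?mulmx0. Qed.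

Lemma vcausalD u v : vcausal u -> vcausal v -> vcausal (fun s => u s + v s).
Proof. by move=> cu cv s s0; rewrite cu ?cv ?addr0. Qed.

Lemma vcausalN u : vcausal u -> vcausal (fun s => - u s).
Proof. by move=> cu s s0; rewrite cu ?oppr0. Qed.

Section Iteration.
Variables (m T h b1 b2 : R) (A Om : 'M[R]_d) (z0 S : R -> 'cV[R]_d) (a0 a1 : 'cV[R]_d).
Hypotheses (m1 : 1 < m) (h0 : 0 < h) (b10 : 0 < b1) (b20 : 0 < b2).
Hypotheses (sz : vrintegrable z0) (cz : vcausal z0) (sS : vrintegrable S) (cS : vcausal S).
Hypothesis zE : forall t i, 0 < t <= T ->
  z0 t i ord0 = a0 i ord0 * ker b1 t + a1 i ord0 * ker b2 t +
    conv (ker m) (fun s => (S s - (A *m z0 s + Om *m z0 (s - h))) i ord0) t.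
Notation Q := (Qmx A Om).

Let F s := S s - (A *m z0 s + Om *m z0 (s - h)).

Let sF : vrintegrable F.
Proof.
apply: vrintegrableB => //; apply: vrintegrableD; apply: vrintegrable_mul => //.
exact: vrintegrable_shift.
Qed.

Let cF : vcausal F.
Proof.
apply: vcausalD => //; apply: vcausalN; apply: vcausalD; apply: vcausal_mul => //.
by apply: vcausal_shift => //; exact: ltW h0.
Qed.

Let vconvF c t : 1 <= c ->
  vconv c F t = vconv c S t - (A *m vconv c z0 t + Om *m vconv c z0 (t - h)).
Proof.
move=> c1; have szh := vrintegrable_shift h sz.
have czh := vcausal_shift (ltW h0) cz.
have sA := vrintegrable_mul A sz; have cA := vcausal_mul A cz.
have sO := vrintegrable_mul Om szh; have cO := vcausal_mul Om czh.
have sAO := vrintegrableD sA sO; have cAO := vcausalD cA cO.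
rewrite (vconvD t c1 sS cS (vrintegrableN sAO) (vcausalN cAO)).
rewrite (vconvN t c1 sAO cAO) (vconvD t c1 sA cA sO cO).
by rewrite (vconv_mul A t c1 sz cz) (vconv_mul Om t c1 szh czh) (vconv_shift c h t sz).
Qed.

(** The fractional integral of order [n * m] of [z0]. *)
Definition iterated (n : nat) : R -> 'cV[R]_d :=
  if n is 0%N then z0 else vconv (n%:R * m) z0.

Arguments iterated : simpl never.

(** The fractional integral of order [n * m] of the known terms of the equation. *)
Definition iterated_source (n : nat) t : 'cV[R]_d :=
  ker (n%:R * m + b1) t *: a0 + ker (n%:R * m + b2) t *: a1 + vconv (n.+1%:R * m) S t.

Lemma iterated_causal n : vcausal (iterated n).
Proof. by case: n => // n; exact: vconv_causal. Qed.

Lemma iterated_source_causal n : vcausal (iterated_source n).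
Proof.
by move=> s s0; rewrite /iterated_source !rl_kernel_npos// !scale0r !add0r vconv_causal.
Qed.

(** The fractional integral of order [n * m] of the Volterra equation. *)
Lemma iterated_step n t : t <= T ->
  iterated n t = iterated_source n t -
    (A *m iterated n.+1 t + Om *m iterated n.+1 (t - h)).
Proof.
move=> tT; have [t0|t0] := leP t 0.
  rewrite !iterated_causal ?iterated_source_causal//; last by move: h0; lra.
  by rewrite !mulmx0 addr0 subr0.
have n1 k : 1 <= k.+1%:R * m.
  by rewrite (le_trans (ltW m1))// ler_peMl ?ler1n// ltW//; move: m1; lra.
rewrite /iterated_source -addrA -(vconvF t (n1 n)); apply/colP => i; rewrite !mxE.
case: n => [|n].
  by rewrite !mul0r !add0r mul1r zE ?t0// (mulrC (ker b1 t)) (mulrC (ker b2 t)).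
rewrite [LHS]mxE.
transitivity (conv (ker (n.+1%:R * m)) (fun s => a0 i ord0 * ker b1 s +
    a1 i ord0 * ker b2 s + conv (ker m) (fun s => F s i ord0) s) t).
  apply: eq_conv_before; [exact: causal_ker|exact: causal_coord| |].
    move=> s s0; rewrite !rl_kernel_npos// !mulr0 !add0r.
    by apply: conv_causal => //; [exact: causal_ker|exact: causal_coord].
  by move=> s /andP[s0 st]; apply: zE; rewrite s0 ltW// (lt_le_trans st).
have m0 : 0 < m by move: m1; lra.
have c0 : 0 < n.+1%:R * m by move: (n1 n); lra.
rewrite (mulrC (ker _ t) (a0 i ord0)) (mulrC (ker _ t) (a1 i ord0)).
have nm : n.+1%:R * m + m = n.+2%:R * m by rewrite -(natr1 n.+1) mulrDl mul1r.
exact: (conv_ker_lin _ _ t c0 b10 b20 m0 (n1 n.+1) (erefl _) (erefl _) nm (sF i)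
  (causal_coord i cF)).
Qed.

(** Each further substitution appends one letter to the words of the remainder:
    [A], or [Om] with one more delay [h].  This is the recursion [QmxSr].  At most
    [M] delays matter, because [z0] vanishes to the left of 0 and [t <= M * h]. *)
Lemma neumann (M n : nat) t : (0 < M)%N -> t <= T -> t <= M%:R * h ->
  z0 t = \sum_(k < n) \sum_(j < M) (-1) ^+ k *: (Q k j *m iterated_source k (t - j%:R * h))
    + \sum_(j < M) (-1) ^+ n *: (Q n j *m iterated n (t - j%:R * h)).
Proof.
move=> M0 tT tM; elim: n => [|n IH].
  rewrite big_ord0 add0r; case: M M0 tM => // M _ tM; rewrite big_ord_recl.
  rewrite big1 => [|j _]; last by rewrite lift0 Qmx_lt// mul0mx scaler0.
  by rewrite Qmx0l expr0 scale1r mul1mx mul0r subr0 addr0.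
rewrite IH big_ord_recr /= -addrA; congr (_ + _).
have jT (j : nat) : t - j%:R * h <= T.
  by apply: le_trans tT; rewrite gerBl mulr_ge0// ltW.
rewrite (eq_bigr (fun j : 'I_M => (-1) ^+ n *: (Q n j *m iterated_source n (t - j%:R * h)) -
    (-1) ^+ n *: (Q n j *m (A *m iterated n.+1 (t - j%:R * h) +
      Om *m iterated n.+1 (t - j%:R * h - h))))); last first.
  by move=> j _; rewrite (iterated_step n (jT j)) mulmxBr scalerBr.
rewrite sumrB; congr (_ + _); rewrite -sumrN.
pose Z (j : nat) := iterated n.+1 (t - j%:R * h).
have term (P : 'M[R]_d) (X Y : 'cV[R]_d) : - ((-1) ^+ n *: (P *m (A *m X + Om *m Y))) =
    (-1) ^+ n.+1 *: (P *m A *m X) + (-1) ^+ n.+1 *: (P *m Om *m Y).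
  by rewrite exprS mulN1r !scaleNr mulmxDr !mulmxA scalerDr opprD.
rewrite (eq_bigr (fun j : 'I_M => (-1) ^+ n.+1 *: (Q n j *m A *m Z j) +
    (-1) ^+ n.+1 *: (Q n j *m Om *m Z j.+1))); last first.
  move=> j _; rewrite term /Z; congr (_ + _ *: (_ *m iterated _ _)).
  by rewrite -natr1 mulrDl mul1r opprD addrA.
rewrite [RHS](_ : _ = \sum_(j < M) (-1) ^+ n.+1 *: (Q n.+1 j *m Z j))//.
have ZM : Z M = 0 by rewrite /Z iterated_causal// subr_le0.
clearbody Z; clear -M0 ZM; rewrite big_split /=.
(* shift the index of the delayed terms by 1; the term of [Z M = 0] drops out *)
pose P (j : nat) := if j is j'.+1 then Q n j' *m Om else 0.
have E : \sum_(j < M) (-1) ^+ n.+1 *: (Q n j *m Om *m Z j.+1) =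
    \sum_(j < M) (-1) ^+ n.+1 *: (P j *m Z j).
  case: M M0 ZM => // M _ ZM.
  rewrite big_ord_recr big_ord_recl /= ZM mulmx0 scaler0 addr0.
  by rewrite mul0mx scaler0 add0r.
rewrite [X in _ + X = _]E -big_split /=; apply: eq_bigr => j _.
by rewrite -scalerDr -mulmxDl QmxSr.
Qed.

End Iteration.
End Neumann.

(** * Convergence of the delayed Mittag-Leffler series *)

Section MatrixLimits.
Context {R : realType}.

Lemma cvg_mx (p r : nat) (u : nat -> 'M[R]_(p, r)) (L : 'M[R]_(p, r)) :
  (forall i j, u n i j @[n --> \oo] --> L i j) -> u n @[n --> \oo] --> L.
Proof.
move=> H; apply/cvgrPdist_le => e e0.
have N : \forall n \near \oo, forall i j, `|L i j - u n i j| <= e.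
  apply: filter_forall => i; apply: filter_forall => j.
  by have /cvgrPdist_le := H i j; apply.
apply: filterS N => n Hn; apply: mx_norm_le => [|i j]; first exact: ltW.
by rewrite !mxE.
Qed.

Lemma cvg_mx_coord (p r : nat) (u : nat -> 'M[R]_(p, r)) (L : 'M[R]_(p, r)) i j :
  u n @[n --> \oo] --> L -> u n i j @[n --> \oo] --> L i j.
Proof.
by move=> H; exact: (cvg_comp _ (fun M : 'M[R]_(p, r) => M i j) H (@coord_continuous _ _ _ i j L)).
Qed.

Lemma cvg_sum_ord (p : nat) (u : 'I_p -> nat -> R) (L : 'I_p -> R) :
  (forall i, u i n @[n --> \oo] --> L i) -> \sum_i u i n @[n --> \oo] --> \sum_i L i.
Proof.
move=> H; elim: (index_enum _) => [|i s IH].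
  by rewrite big_nil; under eq_fun do rewrite big_nil; exact: cvg_cst.
by rewrite big_cons; under eq_fun do rewrite big_cons; exact: cvgD.
Qed.

Lemma cvg_series_geometric (u : nat -> R) (C : R) :
  (forall k, `|u k| <= C * 2^-1 ^+ k) -> cvgn (series u).
Proof.
move=> H; apply: normed_cvg; apply: series_le_cvg (is_cvg_geometric_series (a := C) (z := 2^-1) _).
- by move=> n; exact: normr_ge0.
- by move=> n /=; apply: le_trans (H n).
- exact: H.
- by rewrite ger0_norm ?invr_ge0// invf_lt1 ?ltr1n.
Qed.

End MatrixLimits.

Section DelayedMLLimit.
Context {R : realType} {d : nat}.
Notation mu := (@lebesgue_measure R).
Notation ker := rl_kernel.
Variables (m T h : R) (A Om : 'M[R]_d) (M : nat).
Hypotheses (m1 : 1 < m) (T0 : 0 < T) (h0 : 0 < h) (TM : T <= M%:R * h).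
Notation Q := (Qmx A Om).

(** The powers of the definition of [delayed_ML], normalized and truncated, are
    kernels of order [k * m + g]. *)
Definition ML_term g t (k j : nat) : 'M[R]_d :=
  ((-1) ^+ k * ker (k%:R * m + g) (t - j%:R * h)) *: Q k j.

Definition ML_partial g (n : nat) t : 'M[R]_d := \sum_(k < n) \sum_(j < M) ML_term g t k j.

(** The two truncations differ where the power is [0 `^ 0 = 1], that is for [k = 0],
    [g = 1] and [t <= j * h]; there [Q 0 j = 0], unless [j = 0] and [t <= 0].  Hence
    the hypothesis on [t] and [g]. *)
Lemma ML_termE g t k j : 0 < g -> 0 < t \/ 1 < g ->
  ((-1) ^+ k * (Num.max 0 (t - j%:R * h) `^ (k%:R * m + g - 1) / Gamma (k%:R * m + g)))
    *: Q k j = ML_term g t k j.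
Proof.
move=> g0 tg; rewrite /ML_term; have [tj|tj] := leP (t - j%:R * h) 0; last first.
  by rewrite rl_kernelE.
rewrite rl_kernel_npos// mulr0 scale0r.
case: k => [|k]; last first.
  rewrite powR0 ?mul0r ?mulr0 ?scale0r//.
  have : 1 <= k.+1%:R * m.
    by rewrite (le_trans (ltW m1))// ler_peMl ?ler1n// ltW// (lt_trans _ m1).
  by move=> km; rewrite gt_eqF//; lra.
rewrite mul0r add0r; case: tg => [t0|g1]; last first.
  by rewrite powR0 ?mul0r ?mulr0 ?scale0r// gt_eqF//; lra.
case: j tj => [|j] tj; last by rewrite Qmx_lt// scaler0.
by exfalso; move: tj; rewrite mul0r subr0 leNgt t0.
Qed.

(** The decay of the kernels beats the growth of [Q k j].  An order below 1,
    for which the kernel is unbounded near 0, can only occur for [k = 0]. *)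
Lemma ML_term_bound : exists2 C : R, 0 <= C &
  forall g t (k j : nat) i l, t <= T -> 0 < g -> (0 < k)%N \/ 1 <= g ->
  `|ML_term g t k j i l| <= C * 2^-1 ^+ k.
Proof.
have [C C0 HC] := ker_geometric T0 (letter_norm_ge0 A Om).
exists C => // g t k j i l tT g0 kg.
have x1 : 1 <= k%:R * m + g /\ k%:R <= k%:R * m + g.
  have kk : k%:R <= k%:R * m :> R by rewrite ler_peMr ?ler0n// ltW.
  split; last by move: g0; lra.
  case: kg => [k0|g1]; last by have := ler0n R k; lra.
  have : 1 <= k%:R :> R by rewrite ler1n.
  by move: g0; lra.
rewrite !mxE normrM normrM normrX normrN1 expr1n mul1r.
rewrite ger0_norm; last by apply: rl_kernel_ge0; move: x1; lra.
apply: le_trans (HC k _ (t - j%:R * h) x1.2 x1.1 _); last first.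
  by apply: le_trans tT; rewrite gerBl mulr_ge0// ltW.
apply: ler_wpM2l; first by apply: rl_kernel_ge0; move: x1; lra.
exact: le_trans (normr_coord _ _ _) (Qmx_norm _ _ _ _).
Qed.

Lemma ML_term_cvg g t j i l : t <= T -> 0 < g ->
  cvgn (series (fun k => ML_term g t k j i l)).
Proof.
move=> tT g0; have [C C0 HC] := ML_term_bound.
apply: (@cvg_series_geometric _ _ (C + `|ML_term g t 0 j i l|)) => -[|k].
  by rewrite expr0 mulr1 lerDr.
apply: le_trans (HC g t k.+1 j i l tT g0 (or_introl isT)) _.
by rewrite ler_wpM2r ?exprn_ge0 ?invr_ge0// lerDl.
Qed.

Definition ML_row g t j : 'M[R]_d :=
  \matrix_(i, l) limn (series (fun k => ML_term g t k j i l)).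

Lemma series_mx (p r : nat) (u : nat -> 'M[R]_(p, r)) n i l :
  series u n i l = series (fun k => u k i l) n.
Proof. by rewrite !seriesEnat /= summxE. Qed.

Lemma ML_row_cvg g t j : t <= T -> 0 < g ->
  series (fun k => ML_term g t k j) n @[n --> \oo] --> ML_row g t j.
Proof.
move=> tT g0; apply: cvg_mx => i l; rewrite mxE.
under eq_fun do rewrite series_mx.
exact: ML_term_cvg.
Qed.

Lemma ML_row_vanish g t j : t <= j%:R * h -> 0 < g -> ML_row g t j = 0.
Proof.
move=> tj g0; apply/matrixP => i l; rewrite !mxE.
have -> : series (fun k => ML_term g t k j i l) = fun=> 0.
  apply/funext => n; rewrite seriesEnat /= big1// => k _.
  by rewrite /ML_term rl_kernel_npos ?mulr0 ?scale0r ?mxE// subr_le0.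
by apply: lim_cst; exact: Rhausdorff.
Qed.

(** Up to the time [T <= M * h] only the delays [j * h] with [j < M] have elapsed, so
    the outer series is a finite sum. *)
Lemma delayed_MLE g t : t <= T -> 0 < g -> 0 < t \/ 1 < g ->
  delayed_ML h m g A Om t = \sum_(j < M) ML_row g t j.
Proof.
move=> tT g0 tg; rewrite /delayed_ML.
have -> : (fun j : nat => limn (series (fun k : nat =>
    ((-1) ^+ k * (Num.max 0 (t - j%:R * h) `^ (k%:R * m + g - 1) /
      Gamma (k%:R * m + g))) *: Q k j))) = ML_row g t.
  apply/funext => j.
  rewrite (_ : (fun k : nat => _) = fun k => ML_term g t k j); last first.
    by apply/funext => k; exact: ML_termE.
  by apply/cvg_lim; [exact: norm_hausdorff|exact: ML_row_cvg].
apply/cvg_lim; first exact: norm_hausdorff.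
apply: cvg_near_cst; near=> n.
have Mn : (M <= n)%N by near: n; exact: nbhs_infty_ge.
rewrite seriesEnat /= (big_cat_nat (leq0n M) Mn)//= big_mkord [X in _ + X]big_nat_cond.
rewrite [X in _ + X]big1 ?addr0// => j /andP[/andP[Mj _] _].
apply: ML_row_vanish => //; apply: le_trans tT _; apply: le_trans TM _.
by rewrite ler_pM2r// ler_nat.
Unshelve. all: by end_near. Qed.

Lemma ML_partial_cvg g t i l : t <= T -> 0 < g -> 0 < t \/ 1 < g ->
  ML_partial g n t i l @[n --> \oo] --> delayed_ML h m g A Om t i l.
Proof.
move=> tT g0 tg; rewrite delayed_MLE// summxE.
rewrite (_ : (fun n => _) =
  fun n => \sum_(j < M) series (fun k => ML_term g t k j) n i l); last first.
  apply/funext => n; rewrite /ML_partial exchange_big summxE.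
  by apply: eq_bigr => j _; rewrite seriesEord.
by apply: cvg_sum_ord => j; apply: cvg_mx_coord; exact: ML_row_cvg.
Qed.

(** The uniform bound that dominated convergence requires. *)
Lemma ML_partial_bound g : 1 <= g -> exists2 B : R, 0 <= B &
  forall n t i l, t <= T -> `|ML_partial g n t i l| <= B.
Proof.
move=> g1; have [C C0 HC] := ML_term_bound.
have g0 : 0 < g by lra.
exists (2 * (M%:R * C)); first by rewrite !mulr_ge0.
move=> n t i l tT.
have geo : forall n, \sum_(k < n) (2^-1 ^+ k : R) <= 2.
  move=> n'; have : \sum_(k < n') (2^-1 ^+ k : R) = 2 - 2 * 2^-1 ^+ n'.
    elim: n' => [|n' IH]; first by rewrite big_ord0 expr0; lra.
    by rewrite big_ord_recr /= IH exprS; lra.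
  by move=> ->; rewrite gerBl mulr_ge0// exprn_ge0// invr_ge0.
apply: le_trans (_ : \sum_(k < n) (M%:R * C) * 2^-1 ^+ k <= _); last first.
  by rewrite -mulr_sumr mulrC ler_wpM2r// mulr_ge0.
rewrite summxE; apply: le_trans (ler_norm_sum _ _ _) _; apply: ler_sum => k _.
rewrite summxE; apply: le_trans (ler_norm_sum _ _ _) _.
rewrite -mulrA mulr_natl; apply: le_trans (_ : \sum_(j < M) C * 2^-1 ^+ k <= _).
  by apply: ler_sum => j _; apply: HC => //; right.
by rewrite sumr_const card_ord.
Qed.

Lemma measurable_ML_partial g n i l : measurable_fun [set: R] (fun t => ML_partial g n t i l).
Proof.
rewrite (_ : (fun t => _) = fun t => \sum_(k < n) \sum_(j < M)
    ((-1) ^+ k * Q k j i l) * ker (k%:R * m + g) (t - j%:R * h)).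
  apply: measurable_sum => k; apply: measurable_sum => j; apply: measurable_funM => //.
  apply: (measurableT_comp (measurable_rl_kernel _)); exact: measurable_funB.
apply/funext => t; rewrite /ML_partial summxE; apply: eq_bigr => k _.
by rewrite summxE; apply: eq_bigr => j _; rewrite !mxE mulrAC.
Qed.

End DelayedMLLimit.

(** * Representation of the solution by the series *)

Section Representation.
Context {R : realType} {d : nat}.
Notation mu := (@lebesgue_measure R).
Notation ker := rl_kernel.
Variables (m T h : R) (A Om : 'M[R]_d) (M : nat).
Hypotheses (m1 : 1 < m) (T0 : 0 < T) (h0 : 0 < h) (TM : T <= M%:R * h).
Notation Q := (Qmx A Om).
Notation ML g := (delayed_ML h m g A Om).
Notation MLn g n := (ML_partial m h A Om M g n).

(** Dominated convergence: the partial sums are uniformly bounded up to time [T], and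
    [u] is integrable and vanishes for negative arguments. *)
Lemma conv_ML_cvg (u : R -> R) t i l : t <= T -> rintegrable u -> causal u ->
  rintegrable (fun s => ML m (t - s) i l * u s) /\
  conv (fun tau => MLn m n tau i l) u t @[n --> \oo] -->
    conv (fun tau => ML m tau i l) u t.
Proof.
move=> tT su cu.
have [B B0 HB] := @ML_partial_bound R d m T h A Om M m1 T0 h0 m (ltW m1).
have m0 : 0 < m := lt_trans ltr01 m1.
pose f n s := (MLn m n (t - s) i l * u s)%:E.
pose f' s := (ML m (t - s) i l * u s)%:E.
have mf n : measurable_fun setT (f n).
  apply/measurable_EFinP.
  exact: (measurable_conv_integrand t (@measurable_ML_partial R d m h A Om M m n i l)
    (rintegrable_measurable su)).
have ff' s : f n s @[n --> \oo] --> f' s.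
  have ffr : MLn m n (t - s) i l * u s @[n --> \oo] --> ML m (t - s) i l * u s.
    have [s0|s0] := leP s 0.
      by rewrite cu// mulr0; under eq_fun do rewrite mulr0; exact: cvg_cst.
    apply: cvgM; last exact: cvg_cst.
    by apply: (@ML_partial_cvg R d m T h A Om M) => //; [lra|right].
  by apply: cvg_EFin; [near=> n|exact: ffr].
have mf' : measurable_fun setT f'.
  by apply: (emeasurable_fun_cvg f) => // s _; exact: ff'.
have ig : rintegrable (fun s => B * `|u s|).
  by apply: rintegrableZ; exact: (integrable_abse su).
have dom n s : (`|f n s| <= (B * `|u s|)%:E)%E.
  rewrite /f /= lee_fin normrM; have [s0|s0] := leP s 0.
    by rewrite cu// normr0 !mulr0.
  by rewrite ler_wpM2r// HB//; lra.
have [||i1 _ i3] := @dominated_convergence _ _ _ mu setT measurableT f f'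
  (EFin \o (fun s => B * `|u s|)) mf mf' _ ig.
- by apply: aeW => s _; exact: ff'.
- by apply: aeW => s n _; exact: dom.
split; first exact: i1.
rewrite /conv /Rintegral; apply: fine_cvg; rewrite fineK; last exact: integrable_fin_num.
exact: i3.
Unshelve. all: by end_near. Qed.

Variables (b1 b2 : R) (z0 S : R -> 'cV[R]_d) (a0 a1 : 'cV[R]_d).
Hypotheses (b10 : 0 < b1) (b20 : 0 < b2).
Hypotheses (sz : vrintegrable z0) (cz : vcausal z0) (sS : vrintegrable S) (cS : vcausal S).
Hypothesis zE : forall t i, 0 < t <= T ->
  z0 t i ord0 = a0 i ord0 * ker b1 t + a1 i ord0 * ker b2 t +
    conv (ker m) (fun s => (S s - (A *m z0 s + Om *m z0 (s - h))) i ord0) t.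

(** The kernel of order [k.+1%:R * m = k%:R * m + m] that convolves the source is the
    [k]-th kernel of the series with [g = m]. *)
Lemma iterated_source_sum n t i :
  (\sum_(k < n) \sum_(j < M)
    (-1) ^+ k *: (Q k j *m iterated_source m b1 b2 S a0 a1 k (t - j%:R * h))) i ord0 =
  (MLn b1 n t *m a0) i ord0 + (MLn b2 n t *m a1) i ord0 +
  \sum_l conv (fun tau => MLn m n tau i l) (fun s => S s l ord0) t.
Proof.
have E (k j : nat) l : rintegrable (fun s => ML_term m h A Om m (t - s) k j i l * S s l ord0)
    /\ \int[mu]_s (ML_term m h A Om m (t - s) k j i l * S s l ord0) =
    (-1) ^+ k * (Q k j i l * vconv (k.+1%:R * m) S (t - j%:R * h) l ord0).
  have km : 1 <= k.+1%:R * m.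
    by rewrite (le_trans (ltW m1))// ler_peMl ?ler1n// ltW// (lt_trans _ m1).
  have I := conv_rintegrable (t - j%:R * h) km (sS l) (causal_coord l cS).
  have F s : ML_term m h A Om m (t - s) k j i l * S s l ord0 =
      ((-1) ^+ k * Q k j i l) * (ker (k.+1%:R * m) (t - j%:R * h - s) * S s l ord0).
    rewrite /ML_term !mxE -(natr1 k) mulrDl mul1r.
    rewrite (_ : t - s - j%:R * h = t - j%:R * h - s); last by lra.
    by move: (ker _ _) => K; rewrite -!mulrA; congr (_ * _); rewrite mulrCA.
  have FE := funext F; rewrite FE; split; first exact: rintegrableZ.
  by rewrite RintegralZl// -mulrA /vconv mxE.
have G l : conv (fun tau => MLn m n tau i l) (fun s => S s l ord0) t =
    \sum_(k < n) \sum_(j < M)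
      (-1) ^+ k * (Q k j i l * vconv (k.+1%:R * m) S (t - j%:R * h) l ord0).
  rewrite /conv.
  rewrite (_ : (fun s => _) = fun s => \sum_(k < n) \sum_(j < M)
     (ML_term m h A Om m (t - s) k j i l * S s l ord0)); last first.
    apply/funext => s; rewrite /ML_partial summxE mulr_suml; apply: eq_bigr => k _.
    by rewrite summxE mulr_suml.
  rewrite Rintegral_sum => [|k].
    apply: eq_bigr => k _; rewrite Rintegral_sum => [|j]; last exact: (E k j l).1.
    by apply: eq_bigr => j _; rewrite (E k j l).2.
  by apply: rintegrable_sum => j; exact: (E k j l).1.
have X g (a : 'cV[R]_d) : (MLn g n t *m a) i ord0 =
    \sum_(k < n) \sum_(j < M) \sum_l ML_term m h A Om g t k j i l * a l ord0.
  rewrite /ML_partial mulmx_suml summxE; apply: eq_bigr => k _.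
  by rewrite mulmx_suml summxE; apply: eq_bigr => j _; rewrite mxE.
have -> : \sum_l conv (fun tau => MLn m n tau i l) (fun s => S s l ord0) t =
    \sum_(k < n) \sum_(j < M) \sum_l
      (-1) ^+ k * (Q k j i l * vconv (k.+1%:R * m) S (t - j%:R * h) l ord0).
  rewrite (eq_bigr _ (fun l _ => G l)) exchange_big /=.
  by apply: eq_bigr => k _; rewrite exchange_big.
rewrite !X summxE -!big_split /=.
apply: eq_bigr => k _; rewrite summxE -!big_split /=.
apply: eq_bigr => j _; rewrite -!big_split /= mxE mxE mulr_sumr.
apply: eq_bigr => l _; rewrite /iterated_source /ML_term.
rewrite [in LHS]mxE [in LHS]mxE.
rewrite [(ker _ _ *: a0) _ _]mxE [(ker _ _ *: a1) _ _]mxE.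
rewrite [(_ *: Q k j) i l]mxE [((_ * ker (_ + b2) _) *: Q k j) i l]mxE.
move: (ker _ _) (ker _ _) (vconv _ _ _ _ _) ((-1) ^+ k) (Q k j i l) (a0 _ _) (a1 _ _).
by move=> *; ring.
Qed.

(** The remainder decays geometrically, by [ker_geometric] and [Qmx_norm]. *)
Lemma iterated_cvg t i : t <= T ->
  (\sum_(j < M) (-1) ^+ n *: (Q n j *m iterated m z0 n (t - j%:R * h))) i ord0
    @[n --> \oo] --> 0.
Proof.
move=> tT; have [C C0 HC] := ker_geometric T0 (letter_norm_ge0 A Om).
pose K : R := \sum_l \int[mu]_s `|z0 s l ord0|.
have I0 l : 0 <= \int[mu]_s `|z0 s l ord0| by exact: Rintegral_ge0.
have B n : (0 < n)%N ->
  `|(\sum_(j < M) (-1) ^+ n *: (Q n j *m iterated m z0 n (t - j%:R * h))) i ord0|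
    <= M%:R * C * K * 2^-1 ^+ n.
  case: n => // n _; rewrite summxE; apply: le_trans (ler_norm_sum _ _ _) _.
  apply: (@le_trans _ _ (\sum_(j < M) C * K * 2^-1 ^+ n.+1)); last first.
    by rewrite sumr_const card_ord -!mulrA mulr_natl.
  apply: ler_sum => j _; rewrite !mxE normrM normrX normrN1 expr1n mul1r.
  apply: le_trans (ler_norm_sum _ _ _) _; rewrite /K mulrAC mulr_sumr.
  have jT : t - j%:R * h <= T by apply: le_trans tT; rewrite gerBl mulr_ge0// ltW.
  have n1 : n.+1%:R <= n.+1%:R * m by rewrite ler_peMr// ltW.
  have x1 : 1 <= n.+1%:R * m by apply: le_trans n1; rewrite ler1n.
  have x0 : 0 < n.+1%:R * m by exact: lt_le_trans x1.
  apply: ler_sum => l _; rewrite normrM /iterated /vconv mxE.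
  have H := conv_norm_le (t - j%:R * h) x1 (sz l) (causal_coord l cz).
  have Qn : `|Q n.+1 j i l| <= letter_norm A Om ^+ n.+1.
    exact: le_trans (normr_coord _ _ _) (Qmx_norm _ _ _ _).
  apply: le_trans (ler_pM (normr_ge0 _) (normr_ge0 _) Qn H) _.
  rewrite mulrA; apply: ler_wpM2r => //; rewrite mulrC; exact: HC.
apply/cvgrPdist_le => e e0.
have /cvgrPdist_le /(_ e e0) N := @cvg_geometric R (M%:R * C * K) 2^-1 ltac:(by
  rewrite ger0_norm ?invr_ge0// invf_lt1 ?ltr1n).
near=> n; rewrite sub0r normrN.
have n0 : (0 < n)%N by near: n; exact: nbhs_infty_gt.
apply: le_trans (B n n0) _.
have : `|0 - geometric (M%:R * C * K) 2^-1 n| <= e by near: n.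
rewrite sub0r normrN /= ger0_norm// mulr_ge0 ?exprn_ge0 ?invr_ge0// !mulr_ge0//.
exact: sumr_ge0.
Unshelve. all: by end_near. Qed.

(** The limit [n --> oo] in [neumann]. *)
Lemma representation t i : 0 < t <= T ->
  z0 t i ord0 = (ML b1 t *m a0) i ord0 + (ML b2 t *m a1) i ord0 +
    \sum_l conv (fun tau => ML m tau i l) (fun s => S s l ord0) t.
Proof.
move=> /andP[t0 tT]; have tM : t <= M%:R * h := le_trans tT TM.
have M0 : (0 < M)%N.
  by rewrite lt0n; apply: contraTneq tM => ->; rewrite mul0r -ltNge.
have mulcv g (a : 'cV[R]_d) : 0 < g ->
    (MLn g n t *m a) i ord0 @[n --> \oo] --> (ML g t *m a) i ord0.
  move=> g0; rewrite mxE; under eq_fun do rewrite mxE.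
  apply: cvg_sum_ord => l; apply: cvgM; last exact: cvg_cst.
  by apply: (@ML_partial_cvg R d m T h A Om M) => //; left.
have lim1 : (MLn b1 n t *m a0) i ord0 + (MLn b2 n t *m a1) i ord0 +
    \sum_l conv (fun tau => MLn m n tau i l) (fun s => S s l ord0) t
    + (\sum_(j < M) (-1) ^+ n *: (Q n j *m iterated m z0 n (t - j%:R * h))) i ord0
    @[n --> \oo] --> (ML b1 t *m a0) i ord0 + (ML b2 t *m a1) i ord0 +
    \sum_l conv (fun tau => ML m tau i l) (fun s => S s l ord0) t + 0.
  apply: cvgD; last exact: iterated_cvg.
  apply: cvgD; first by apply: cvgD; exact: mulcv.
  apply: cvg_sum_ord => l; apply: (conv_ML_cvg i l tT (sS l) (causal_coord l cS)).2.
rewrite addr0 in lim1; apply: (cvg_unique _ _ lim1); first exact: Rhausdorff.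
apply: cvg_near_cst; near=> n.
have N := neumann m1 h0 b10 b20 sz cz sS cS zE n M0 tT tM.
by rewrite -iterated_source_sum [in RHS]N [RHS]mxE.
Unshelve. all: by end_near. Qed.

End Representation.

(** * The formula in terms of the data *)

Lemma Rintegral_supported {R : realType} (F G : R -> R) a b : rintegrable G ->
  (forall s, a < s < b -> F s = G s) -> (forall s, s <= a \/ b < s -> G s = 0) ->
  \int[lebesgue_measure]_s G s = \int[lebesgue_measure]_(s in `[a, b]) F s.
Proof.
move=> sG FG G0.
have mG : measurable_fun `]a, b[ G.
  by apply: measurable_funTS; exact: rintegrable_measurable.
have FGi : {in `]a, b[%classic, F =1 G}.
  by move=> s; rewrite inE /= in_itv => /= /FG.
have mF : measurable_fun `]a, b[ F.
  by apply: (eq_measurable_fun G) mG => s /FGi.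
rewrite Rintegral_cc_oo//.
have -> : \int[lebesgue_measure]_(s in `]a, b[) F s =
    \int[lebesgue_measure]_(s in `]a, b[) G s by exact: eq_Rintegral.
rewrite -Rintegral_cc_oo//.
rewrite -Rintegral_itv_obnd_cbnd; last exact: rintegrable_itv.
rewrite [RHS]Rintegral_mkcond; apply: eq_Rintegral => s _; rewrite patchE; case: ifPn => //.
rewrite notin_setE /= in_itv /= => /negP; rewrite negb_and -leNgt -ltNge => /orP sab.
exact: G0.
Qed.

Section Formula.
Context {R : realType} {d : nat}.
Notation mu := (@lebesgue_measure R).
Variables (m nu h T : R) (A Om : 'M[R]_d) (M : nat).
Hypotheses (m1 : 1 < m) (T0 : 0 < T) (h0 : 0 < h) (TM : T <= M%:R * h).
Notation Y := (delayed_ML h m m A Om).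

Lemma delayed_ML_npos t : t <= 0 -> Y t = 0.
Proof.
move=> t0; have m0 : 0 < m := lt_trans ltr01 m1.
rewrite (@delayed_MLE R d m T h A Om M)//; [|exact: le_trans t0 (ltW T0)|by right].
rewrite big1// => j _; apply: ML_row_vanish => //.
by rewrite (le_trans t0)// mulr_ge0// ltW.
Qed.

(** The matrix form of the sum of convolutions in [representation]. *)
Lemma delayed_ML_conv (v : R -> 'cV[R]_d) t i : t <= T -> vrintegrable v -> vcausal v ->
  rintegrable (fun s => (Y (t - s) *m v s) i ord0) /\
  \int[mu]_s ((Y (t - s) *m v s) i ord0) =
  \sum_l conv (fun tau => Y tau i l) (fun s => v s l ord0) t.
Proof.
move=> tT sv cv.
have I l : rintegrable (fun s => Y (t - s) i l * v s l ord0).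
  exact: (conv_ML_cvg A Om m1 T0 h0 TM i l tT (sv l) (causal_coord l cv)).1.
have E : (fun s => (Y (t - s) *m v s) i ord0) =
    fun s => \sum_l Y (t - s) i l * v s l ord0.
  by apply/funext => s; rewrite mxE.
rewrite E; split; first exact: rintegrable_sum.
by rewrite Rintegral_sum.
Qed.

Variables (f phi : R -> 'cV[R]_d).
Hypothesis hf : {within `[0, T], continuous f}.
Hypothesis hphi : C1_segment (- h) 0 phi.

(** The source is a difference of two terms; in the term of the history, the variable
    is translated by [h].  The support of [Y] and of the cut-off functions reduces
    the integrals over the line to the intervals. *)
Lemma source_formula t i : 0 < t <= T ->
  \sum_l conv (fun tau => Y tau i l) (fun s => source_part h T Om f phi s l ord0) t =
  vintegral `[0, t] (fun s => Y (t - s) *m f s) i ord0 -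
  vintegral `[- h, 0] (fun s => Y (t - s - h) *m Om *m phi s) i ord0.
Proof.
move=> /andP[t0 tT].
pose v1 := cutoff 0 T f; pose v2 s := Om *m cutoff (- h) 0 phi (s - h).
have s1 : vrintegrable v1 by exact/vrintegrable_cutoff/vintegrable_continuous.
have c1 : vcausal v1 by exact: vcausal_cutoff.
have s2 : vrintegrable v2.
  apply: vrintegrable_mul; apply: (vrintegrable_shift h).
  exact/vrintegrable_cutoff/vintegrable_continuous/C1_segment_continuous.
have c2 : vcausal v2.
  move=> s s0; rewrite /v2 /cutoff (_ : - h < s - h = false) ?mulmx0//.
  by apply/negbTE; rewrite -leNgt; lra.
have [I1 _] := delayed_ML_conv i tT s1 c1.
have [I2 _] := delayed_ML_conv i tT s2 c2.
rewrite -(delayed_ML_conv i tT (vrintegrable_source_part Om hf hphi)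
  (vcausal_source_part h T Om f phi)).2.
rewrite (_ : (fun s => _) = fun s =>
  (Y (t - s) *m v1 s) i ord0 - (Y (t - s) *m v2 s) i ord0); last first.
  by apply/funext => s; rewrite /source_part mulmxBr !mxE.
rewrite RintegralB//; congr (_ - _).
  rewrite mxE; apply: Rintegral_supported => // s.
    by move=> /andP[s0 st]; rewrite /v1 /cutoff s0/= ltW//; lra.
  case=> [s0|ts]; first by rewrite c1// mulmx0 mxE.
  by rewrite delayed_ML_npos ?mul0mx ?mxE//; lra.
pose H s := (Y (t - s - h) *m Om *m cutoff (- h) 0 phi s) i ord0.
have HE s : (Y (t - s) *m v2 s) i ord0 = H (s - h).
  have -> : t - s = t - (s - h) - h by ring.
  by rewrite /H /v2 mulmxA.
have sH : rintegrable H.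
  rewrite (_ : H = fun s => (fun r => (Y (t - r) *m v2 r) i ord0) (s - - h)).
    exact: (rintegrable_shift (- h) I2).
  by apply/funext => s /=; rewrite HE opprK addrK.
rewrite (_ : (fun s => _) = fun s => H (s - h)); last exact/funext.
rewrite Rintegral_shift; last exact: rintegrable_measurable.
rewrite mxE; apply: Rintegral_supported => // s.
  by move=> /andP[sh s0]; rewrite /H /cutoff sh ltW.
move=> sE; rewrite /H /cutoff ifF ?mulmx0 ?mxE//; apply/negbTE; rewrite negb_and -leNgt -ltNge.
exact/orP.
Qed.

End Formula.

Theorem theorem9 (R : realType) (d : nat) (mu nu h T : R)
  (A Omega : 'M[R]_d) (f phi z : R -> 'cV[R]_d) (a0 a1 : 'cV[R]_d)
  (hmu : 1 < mu < 2) (hnu : 0 <= nu <= 1) (hh : 0 < h) (hT : 0 < T)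
  (hf : {within `[0, T], continuous f})
  (hphi : C1_segment (- h) 0 phi)
  (hz : hilfer_regular mu nu T z)
  (hz_eq : {ae lebesgue_measure, forall t : R, t \in `]0, T[ ->
     hilfer 2 0 mu nu z t + A *m z t + Omega *m z (t - h) = f t})
  (hz_phi : forall t : R, t \in `[- h, 0] -> z t = phi t)
  (hz_a0 : frac_int 0 ((1 - nu) * (2 - mu)) z t @[t --> 0^'+] --> a0)
  (hz_a1 : frac_int_pred 0 ((1 - nu) * (2 - mu)) z t @[t --> 0^'+] --> a1) :
  forall t : R, 0 < t <= T ->
    z t =
      delayed_ML h mu ((mu - 2) * (1 - nu) + 1) A Omega t *m a0
      + delayed_ML h mu ((mu - 2) * (1 - nu) + 2) A Omega t *m a1
      - vintegral `[- h, 0] (fun s =>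
          delayed_ML h mu mu A Omega (t - s - h) *m Omega *m phi s)
      + vintegral `[0, t] (fun s =>
          delayed_ML h mu mu A Omega (t - s) *m f s).
Proof.
move=> t tT.
have [b1 b1E] : exists b1, b1 = (mu - 2) * (1 - nu) + 1 by eexists.
have [b2 b2E] : exists b2, b2 = (mu - 2) * (1 - nu) + 2 by eexists.
rewrite -b1E -b2E.
have [/andP[mu1 mu2] /andP[nu0 nu1]] := conj hmu hnu.
have b10 : 0 < b1 by rewrite b1E; nra.
have b20 : 0 < b2 by rewrite b2E; nra.
have b1E' : b1 = 1 - (1 - nu) * (2 - mu) by rewrite b1E; ring.
have b2E' : b2 = 2 - (1 - nu) * (2 - mu) by rewrite b2E; ring.
have [M TM] : exists M : nat, T <= M%:R * h.
  exists (Num.truncn (T / h)).+1; rewrite -ler_pdivrMr//.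
  exact/ltW/truncnS_gt.
have V := hilfer_volterra hmu hnu hh hT b1E' b2E' hf hphi hz hz_eq hz_phi hz_a0 hz_a1.
have V' (s : R) i : 0 < s <= T -> solution_part T z s i ord0 =
    a0 i ord0 * rl_kernel b1 s + a1 i ord0 * rl_kernel b2 s +
    conv (rl_kernel mu) (fun s => (source_part h T Omega f phi s -
      (A *m solution_part T z s + Omega *m solution_part T z (s - h))) i ord0) s.
  by move=> sT; rewrite {1}/solution_part /cutoff sT; exact: V.
apply/colP => i.
have := representation mu1 hT hh TM b10 b20 (vrintegrable_solution_part hz)
  (vcausal_cutoff T z) (vrintegrable_source_part Omega hf hphi)
  (vcausal_source_part h T Omega f phi) V' i tT.
rewrite {1}/solution_part /cutoff tT (source_formula A Omega mu1 hT hh TM hf hphi i tT) => ->.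
rewrite [RHS]mxE [in RHS]mxE [in RHS]mxE.
rewrite [(- vintegral _ _) i ord0]mxE.
by rewrite -!addrA; congr (_ + (_ + _)); rewrite addrC.
Qed.
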